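(* Let $\theta<1$. There exists $\lambda_0>0$ such that, for any $\lambda\in(0,\lambda_0)$, $E_\lambda$ admits a unique critical point $\chi_\lambda$ in $\mathcal H$, and $\chi_\lambda\in\mathcal H^{ee}$.
   Context: Fix a parameter $\theta<1$ and set $q_+=\frac{1+\sqrt{1-\theta}}{6}$. A triple $(q_1,q_2,q_3)$ of real functions on $[-1,1]$ is identified with the symmetric traceless matrix-valued map $$Q(x)=\begin{pmatrix}-2q_1(x)&0&0\\0&q_1(x)-q_2(x)&q_3(x)\\0&q_3(x)&q_1(x)+q_2(x)\end{pmatrix}.$$ With $|Q|^2=\mathrm{tr}(Q^2)$, let $$f(Q)=\frac{\theta}{6}|Q|^2-\frac23\mathrm{tr}(Q^3)+\frac18|Q|^4+c(\theta)=\frac{\theta}{3}(3q_1^2+q_2^2+q_3^2)+4q_1(q_1^2-q_2^2-q_3^2)+\frac12(3q_1^2+q_2^2+q_3^2)^2+c(\theta),$$ where the constant $c(\theta)$ is chosen so that $\min f=0$. Let $\mathcal H$ be the affine space of $Q=(q_1,q_2,q_3)\in H^1(-1,1)^3$ with $q_1(\pm1)=q_+$, $q_2(-1)=3q_+$, $q_2(1)=-3q_+$, $q_3(\pm1)=0$. For $\lambda>0$ the energy on $\mathcal H$ is $$E_\lambda(Q)=\int_{-1}^1\left(\frac{1}{2\lambda^2}|Q'|^2+f(Q)\right)dx,$$ and a critical point is a $Q\in\mathcal H$ with $DE_\lambda(Q)=0$ in $H^{-1}(-1,1)^3$ (variations in $H^1_0(-1,1)^3$). $\mathcal H^{ee}=\{Q\in\mathcal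 H: q_3\equiv0\}$ is the space of eigenvalue exchange configurations. *)

(* Defs.v *)
From HB Require Import structures.
From mathcomp Require Import all_boot all_order all_algebra.
From mathcomp Require Import all_classical all_reals all_analysis.
From mathcomp Require Import ring lra.
Set Implicit Arguments.
Unset Strict Implicit.
Unset Printing Implicit Defensive.
Import Order.TTheory GRing.Theory Num.Theory.
Import numFieldNormedType.Exports.
Local Open Scope classical_set_scope.
Local Open Scope ring_scope.

(* Functions on [-1, 1] are total functions on R of which only the values on
   [-1, 1] matter. *)

Definition square_integrable (R : realType) (u : R -> R) : Prop :=
  measurable_fun (`[-1, 1] : set R) u /\
  (@lebesgue_measure R).-integrable `[-1, 1] (EFin \o (fun x => u x ^+ 2)).

(* C^1_c(-1, 1), the test functions for weak derivatives in one dimension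
   (as in Brezis, Functional Analysis, Chapter 8) *)
Definition test_function (R : realType) (phi : R -> R) : Prop :=
  [/\ forall x, derivable phi x 1,
      continuous (derive1 phi) &
      exists a b : R, [/\ -1 < a, b < 1 & forall x, x \notin `[a, b] -> phi x = 0]].

Definition is_weak_derivative (R : realType) (u g : R -> R) : Prop :=
  square_integrable g /\
  forall phi : R -> R, test_function phi ->
    \int[lebesgue_measure]_(x in `[-1, 1]) (u x * derive1 phi x) =
    - \int[lebesgue_measure]_(x in `[-1, 1]) (g x * phi x).

(* H^1(-1, 1); each class is represented by its continuous representative on
   [-1, 1], so that boundary values are pointwise values. *)
Definition H1 (R : realType) : set (R -> R) :=
  [set u : R -> R | [/\ {within `[-1, 1], continuous u},
               square_integrable u &
               exists g, is_weak_derivative u g]].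

(* Determined up to equality almost everywhere on [-1, 1] when u is in H1;
   zero when u has no weak derivative in L^2. *)
Definition weak_derivative (R : realType) (u : R -> R) : R -> R :=
  xget (fun=> 0) [set g | is_weak_derivative u g].

Definition q1 (R : realType) (v : R * R * R) : R := v.1.1.
Definition q2 (R : realType) (v : R * R * R) : R := v.1.2.
Definition q3 (R : realType) (v : R * R * R) : R := v.2.

Definition Qmx (R : realType) (v : R * R * R) : 'M[R]_3 :=
  \matrix_(i, j) nth 0 (nth [::]
    [:: [:: - 2 * q1 v; 0;           0           ];
        [:: 0;          q1 v - q2 v; q3 v        ];
        [:: 0;          q3 v;        q1 v + q2 v ]] i) j.

(* |M|^2 for symmetric M *)
Definition sqnorm (R : realType) (M : 'M[R]_3) : R := \tr (M ^+ 2).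

Definition bulk0 (R : realType) (theta : R) (M : 'M[R]_3) : R :=
  theta / 6 * sqnorm M - 2 / 3 * \tr (M ^+ 3) + 1 / 8 * sqnorm M ^+ 2.

(* The constant making the minimum of [bulk] zero, see [bulk_min]. *)
Definition bulk_const (R : realType) (theta : R) : R :=
  - inf [set bulk0 theta (Qmx v) | v in [set: R * R * R]].

Definition bulk (R : realType) (theta : R) (M : 'M[R]_3) : R :=
  bulk0 theta M + bulk_const theta.

Definition weak_derivative3 (R : realType) (Q : R -> R * R * R) :
    R -> R * R * R :=
  fun x => (weak_derivative (@q1 R \o Q) x,
            weak_derivative (@q2 R \o Q) x,
            weak_derivative (@q3 R \o Q) x).

Definition energy (R : realType) (theta lambda : R) (Q : R -> R * R * R) : R :=
  \int[lebesgue_measure]_(x in `[-1, 1])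
    (1 / (2 * lambda ^+ 2) * sqnorm (Qmx (weak_derivative3 Q x))
     + bulk theta (Qmx (Q x))).

Definition H1_3 (R : realType) : set (R -> R * R * R) :=
  [set Q : R -> R * R * R | [/\ H1 (@q1 R \o Q), H1 (@q2 R \o Q) & H1 (@q3 R \o Q)]].

Definition H10_3 (R : realType) : set (R -> R * R * R) :=
  [set P : R -> R * R * R | [/\ H1_3 P, P (-1) = 0 & P 1 = 0]].

Definition qplus (R : realType) (theta : R) : R :=
  (1 + Num.sqrt (1 - theta)) / 6.

Definition Hspace (R : realType) (theta : R) : set (R -> R * R * R) :=
  [set Q : R -> R * R * R | [/\ H1_3 Q,
               Q (-1) = (qplus theta, 3 * qplus theta, 0) &
               Q 1 = (qplus theta, - 3 * qplus theta, 0)]].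

Definition Hee (R : realType) (theta : R) : set (R -> R * R * R) :=
  [set Q : R -> R * R * R | Hspace theta Q /\ forall x, x \in `[-1, 1] -> q3 (Q x) = 0].

(* DE_lambda(Q) = 0 in H^{-1}: the derivative of the energy at Q vanishes in
   every direction of H^1_0. *)
Definition critical_point (R : realType) (theta lambda : R)
    (Q : R -> R * R * R) : Prop :=
  Hspace theta Q /\
  forall P : R -> R * R * R, H10_3 P ->
    is_derive (0 : R) (1 : R) (fun t : R => energy theta lambda (Q + t *: P)) 0.

Lemma sqnormE (R : realType) (v : R * R * R) :
  sqnorm (Qmx v) = 2 * (3 * q1 v ^+ 2 + q2 v ^+ 2 + q3 v ^+ 2).
Proof.
rewrite /sqnorm /mxtrace !big_ord_recl big_ord0 /= !expr2.
rewrite !mxE !big_ord_recl !big_ord0 /= !mxE /=.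
ring.
Qed.

Lemma bulk0E (R : realType) (theta : R) (v : R * R * R) :
  let N := 3 * q1 v ^+ 2 + q2 v ^+ 2 + q3 v ^+ 2 in
  bulk0 theta (Qmx v) =
  theta / 3 * N + 4 * q1 v * (q1 v ^+ 2 - q2 v ^+ 2 - q3 v ^+ 2)
  + 1 / 2 * N ^+ 2.
Proof.
rewrite /bulk0 sqnormE /=.
have -> : \tr (Qmx v ^+ 3) =
    - 6 * q1 v * (q1 v ^+ 2 - q2 v ^+ 2 - q3 v ^+ 2).
  rewrite /mxtrace !big_ord_recl big_ord0 /= !exprS expr0 mulr1.
  rewrite !mxE !big_ord_recl !big_ord0 /= !mxE /=.
  rewrite !big_ord_recl !big_ord0 /= !mxE /=.
  ring.
by field.
Qed.

Lemma bulk0_min (R : realType) (theta : R) : theta < 1 ->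
  exists v0 : R * R * R, forall v,
    bulk0 theta (Qmx v0) <= bulk0 theta (Qmx v).
Proof.
move=> th1.
pose s := qplus theta.
have s16 : 1 / 6 <= s.
  by rewrite /s /qplus; have := sqrtr_ge0 (1 - theta); lra.
have sE : theta = 12 * s - 36 * s ^+ 2.
  have h : Num.sqrt (1 - theta) ^+ 2 = 1 - theta by rewrite sqr_sqrtr; lra.
  move: h; rewrite /s /qplus; move: (Num.sqrt _) => r h.
  have -> : theta = 1 - r ^+ 2 by rewrite h; ring.
  by field.
have low (v : R * R * R) : exists2 t, 0 <= t &
    4 * theta * t ^+ 2 - 32 * t ^+ 3 + 72 * t ^+ 4 <= bulk0 theta (Qmx v).
  rewrite bulk0E /=.
  move: (q1 v) (q2 v) (q3 v) => a b c.
  pose t := Num.sqrt ((3 * a ^+ 2 + b ^+ 2 + c ^+ 2) / 12).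
  have t0 : 0 <= t by rewrite sqrtr_ge0.
  have tE : t ^+ 2 = (3 * a ^+ 2 + b ^+ 2 + c ^+ 2) / 12.
    by rewrite sqr_sqrtr //; have := sqr_ge0 a; have := sqr_ge0 b;
       have := sqr_ge0 c; lra.
  exists t => //.
  have NE : 3 * a ^+ 2 + b ^+ 2 + c ^+ 2 = 12 * t ^+ 2 by rewrite tE; field.
  have dE : a ^+ 2 - b ^+ 2 - c ^+ 2 = 4 * a ^+ 2 - 12 * t ^+ 2.
    by rewrite -NE; ring.
  rewrite NE dE.
  have at0 : 0 <= a + 2 * t.
    have h : a ^+ 2 <= (2 * t) ^+ 2.
      by have := sqr_ge0 b; have := sqr_ge0 c; rewrite exprMn tE; lra.
    have := ler_norm (- a); rewrite normrN => h1.
    have : `|a| <= `|2 * t| by rewrite -ler_sqr ?nnegrE // !real_normK ?num_real.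
    by rewrite (ger0_norm (_ : 0 <= 2 * t)); lra.
  have := mulr_ge0 (sqr_ge0 (a - t)) at0 => h.
  rewrite -subr_ge0.
  rewrite (_ : _ - _ = 16 * ((a - t) ^+ 2 * (a + 2 * t))); last by field.
  by rewrite mulr_ge0.
have [s29|s29] := lerP (2 / 9) s.
  exists (s, 3 * s, 0) => v.
  have [t t0] := low v; apply: le_trans.
  rewrite bulk0E /q1 /q2 /q3 /= sE -subr_ge0.
  rewrite (_ : _ - _ = (t - s) ^+ 2 *
    (72 * t ^+ 2 + 16 * (9 * s - 2) * t + 8 * s * (9 * s - 2))); last by field.
  apply: mulr_ge0; first exact: sqr_ge0.
  by rewrite !addr_ge0 ?mulr_ge0 ?sqr_ge0 //; lra.
exists 0 => v.
have [t t0] := low v; apply: le_trans.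
rewrite bulk0E /q1 /q2 /q3 /=.
have th89 : 8 / 9 <= theta by rewrite sE; nra.
rewrite -subr_ge0.
rewrite (_ : _ - _ = 4 * t ^+ 2 * (theta - 8 / 9 + 2 * (3 * t - 2 / 3) ^+ 2));
  last by field.
apply: mulr_ge0; first by rewrite mulr_ge0 ?sqr_ge0.
by apply: addr_ge0; [rewrite subr_ge0 | rewrite mulr_ge0 ?sqr_ge0].
Qed.

Lemma bulk_min (R : realType) (theta : R) : theta < 1 ->
  (forall v, 0 <= bulk theta (Qmx v)) /\ (exists v, bulk theta (Qmx v) = 0).
Proof.
move=> /bulk0_min[v0 v0P].
suff infE : inf [set bulk0 theta (Qmx v) | v in [set: R * R * R]]
    = bulk0 theta (Qmx v0).
  rewrite /bulk /bulk_const infE; split=> [v|]; first by rewrite subr_ge0.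
  by exists v0; rewrite subrr.
apply/eqP; rewrite eq_le; apply/andP; split.
  apply: ge_inf; last by exists v0.
  by exists (bulk0 theta (Qmx v0)) => _ [v _ <-].
apply: lb_le_inf; first by exists (bulk0 theta (Qmx v0)), v0.
by move=> _ [v _ <-].
Qed.

(* Main.v *)
Require Import Defs.
From HB Require Import structures.
From mathcomp Require Import all_boot all_order all_algebra.
From mathcomp Require Import all_classical all_reals all_analysis.
From mathcomp Require Import measurable_realfun.
From mathcomp Require Import ring lra.
Set Implicit Arguments.
Unset Strict Implicit.
Unset Printing Implicit Defensive.
Import Order.TTheory GRing.Theory Num.Theory.
Import numFieldNormedType.Exports.
Local Open Scope classical_set_scope.
Local Open Scope ring_scope.

(** The potential f is semiconvex: its cubic part has a Hessian of order |Q|,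
    which the quartic part, with a Hessian of order |Q|^2, dominates up to a
    constant. Hence f + K |Q|^2 is convex on the whole space for some K that
    depends only on theta ([bulk_semiconvex]). If Q and Q' are critical points
    and D = Q - Q', test both Euler-Lagrange equations with D and subtract:
    the gradient term is 1 / lambda^2 times the integral of |D'|^2, and the
    potential term is at least - K times the integral of |D|^2. As D vanishes
    at both ends, the Poincare inequality absorbs the second term into the
    first for small lambda, so D = 0 ([critical_point_unique]). As K
    is global, this compares any two critical points, however large.

    A critical point is found by solving the Euler-Lagrange system with q3 = 0,
    which is consistent since the derivative of f in q3 is a multiple of q3.
    The system reads q_i'' = lambda^2 F_i(q1, q2), with F polynomial; written
    with the Green operator of the second derivative it becomes a fixed point
    equation, and for small lambda its right-hand side is a contraction in the
    sup norm on a ball of continuous functions ([profile_fixpoint]). The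
    solution lies in the eigenvalue exchange space by construction, and by
    uniqueness it is the only critical point.

    Both halves need to know that along every direction of H^1 the energy is a
    polynomial in the step whose linear coefficient is the expected first
    variation ([energy_first_variation]). Weak derivatives enter there only
    through a choice, so one needs that they are unique almost everywhere; and
    weak derivatives are tested here against functions with compact support
    only, while the arguments above integrate by parts against functions that
    do not vanish at the ends. The lemma [weak_ibp] provides both: the test
    function is multiplied by a cutoff that tends to the indicator of an
    interval, and the boundary terms are the limits of the integrals against
    the derivative of the cutoff. *)

(** * Integration on the interval from -1 to 1 *)

Section Integration.
Context {R : realType}.
Implicit Types f g u v : R -> R.
Notation mu := (@lebesgue_measure R).
Notation I11 := (`[-1, 1]%classic : set R).

Definition int11 f : R := \int[mu]_(x in I11) f x.
Definition L1 f := mu.-integrable I11 (EFin \o f).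
Definition cont11 f := {within I11, continuous f}.

Lemma measurable11 : measurable (I11 : set (measurableTypeR R)).
Proof. exact: measurable_itv. Qed.

Lemma L1D f g : L1 f -> L1 g -> L1 (fun x => f x + g x).
Proof.
by move=> hf hg; exact (integrableD (mu := mu) measurable11 hf hg).
Qed.

Lemma L1B f g : L1 f -> L1 g -> L1 (fun x => f x - g x).
Proof.
by move=> hf hg; exact (integrableB (mu := mu) measurable11 hf hg).
Qed.

Lemma L1Z (k : R) f : L1 f -> L1 (fun x => k * f x).
Proof.
by move=> hf; exact (integrableZl (mu := mu) measurable11 k hf).
Qed.

Lemma L1_ext f g : (forall x, I11 x -> f x = g x) -> L1 f -> L1 g.
Proof.
move=> fg; apply: (eq_integrable (mu := mu) measurable11).
by move=> x; rewrite inE => xI; rewrite /= fg.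
Qed.

Lemma int11D f g : L1 f -> L1 g ->
  int11 (fun x => f x + g x) = int11 f + int11 g.
Proof. exact: (RintegralD (mu := mu) measurable11). Qed.

Lemma int11B f g : L1 f -> L1 g ->
  int11 (fun x => f x - g x) = int11 f - int11 g.
Proof. exact: (RintegralB (mu := mu) measurable11). Qed.

Lemma int11Z (k : R) f : L1 f -> int11 (fun x => k * f x) = k * int11 f.
Proof. exact: (RintegralZl (mu := mu) k measurable11). Qed.

Lemma int11_ext f g : (forall x, I11 x -> f x = g x) -> int11 f = int11 g.
Proof. by move=> fg; apply: eq_Rintegral => x; rewrite inE => /fg. Qed.

Lemma int11_le f g : L1 f -> L1 g -> (forall x, I11 x -> f x <= g x) ->
  int11 f <= int11 g.
Proof. exact: (le_Rintegral (mu := mu) measurable11). Qed.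

Lemma int11_ge0 f : (forall x, I11 x -> 0 <= f x) -> 0 <= int11 f.
Proof. by move=> f0; exact: (Rintegral_ge0 mu). Qed.

Lemma int11_cst (k : R) : int11 (fun=> k) = 2 * k.
Proof.
rewrite /int11 (Rintegral_cst mu measurable11) mulrC; congr (_ * _).
have muI : mu I11 = 2%:E.
  rewrite lebesgue_measure_itv/= lte_fin ifT; last lra.
  by congr EFin; lra.
exact: (congr1 fine muI).
Qed.

Lemma int11_norm f : L1 f -> `|int11 f| <= int11 (fun x => `|f x|).
Proof. exact: (le_normr_Rintegral (mu := mu) measurable11). Qed.

Lemma L1_norm f : L1 f -> L1 (fun x => `|f x|).
Proof. move=> hf; exact: (integrable_norm (mu := mu) hf). Qed.

Lemma cont11_L1 f : cont11 f -> L1 f.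
Proof.
by move=> cf; apply: continuous_compact_integrable => //; exact: segment_compact.
Qed.

Lemma L1_measurable f : L1 f -> measurable_fun (I11 : set (measurableTypeR R)) f.
Proof. by move=> /measurable_int/measurable_EFinP. Qed.

Lemma cont11_measurable f : cont11 f -> measurable_fun (I11 : set (measurableTypeR R)) f.
Proof. by move=> /cont11_L1/L1_measurable. Qed.

Lemma cont11D f g : cont11 f -> cont11 g -> cont11 (fun x => f x + g x).
Proof. by move=> cf cg x; apply: cvgD; [exact: cf|exact: cg]. Qed.

Lemma cont11M f g : cont11 f -> cont11 g -> cont11 (fun x => f x * g x).
Proof. by move=> cf cg x; apply: cvgM; [exact: cf|exact: cg]. Qed.

Lemma cont11N f : cont11 f -> cont11 (fun x => - f x).
Proof. by move=> cf x; apply: cvgN; exact: cf. Qed.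

Lemma cont11_cst (k : R) : cont11 (fun=> k).
Proof. by move=> x; exact: cvg_cst. Qed.

Lemma cont11X f n : cont11 f -> cont11 (fun x => f x ^+ n).
Proof.
move=> cf; elim: n => [|n IHn]; first exact: cont11_cst.
by under eq_fun do rewrite exprS; exact: cont11M.
Qed.

Lemma cont11_continuous f : continuous f -> cont11 f.
Proof. exact: continuous_subspaceT. Qed.

(** By the inequality 2 |f g| <= f^2 + g^2. *)
Lemma L2_mul f g : square_integrable f -> square_integrable g ->
  L1 (fun x => f x * g x).
Proof.
move=> [mf f2] [mg g2].
have h : L1 (fun x => f x ^+ 2 + g x ^+ 2) by exact: L1D.
apply: (le_integrable (mu := mu) measurable11 _ _ h).
  by apply/measurable_EFinP; exact: measurable_funM.
move=> x _ /=; rewrite lee_fin normrM.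
rewrite [leRHS]ger0_norm ?addr_ge0 ?sqr_ge0//.
rewrite -(real_normK (num_real (f x))) -(real_normK (num_real (g x))).
move: (normr_ge0 (f x)) (normr_ge0 (g x)); move: `|f x| `|g x| => a b.
have := sqr_ge0 (a - b); nra.
Qed.

Lemma cont11_L2 f : cont11 f -> square_integrable f.
Proof.
move=> cf; split; first exact: cont11_measurable.
by apply: cont11_L1; under eq_fun do rewrite expr2; exact: cont11M.
Qed.

Lemma L2_L1 f : square_integrable f -> L1 f.
Proof.
move=> f2; apply: (@L1_ext (fun x => 1 * f x)) => [x _|]; first by rewrite mul1r.
apply: L2_mul => //; apply: cont11_L2; exact: cont11_cst.
Qed.

Lemma L2D f g : square_integrable f -> square_integrable g ->
  square_integrable (fun x => f x + g x).
Proof.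
move=> f2 g2; have fg := L2_mul f2 g2.
case: (f2) (g2) => mf f2' [mg g2']; split; first exact: measurable_funD.
apply: (@L1_ext (fun x => (f x ^+ 2 + g x ^+ 2) + 2 * (f x * g x))).
  by move=> x _; ring.
by apply: L1D; [exact: L1D|exact: L1Z].
Qed.

Lemma L2Z (k : R) f : square_integrable f -> square_integrable (fun x => k * f x).
Proof.
move=> [mf f2]; split; first exact: measurable_funM.
apply: (@L1_ext (fun x => k ^+ 2 * f x ^+ 2)); first by move=> x _; ring.
exact: L1Z.
Qed.

Lemma int11_dominated (F : nat -> R -> R) f k :
  (forall n, measurable_fun (I11 : set (measurableTypeR R)) (F n)) ->
  measurable_fun (I11 : set (measurableTypeR R)) f -> L1 k ->
  (forall n x, I11 x -> `|F n x| <= k x) ->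
  (forall x, I11 x -> F n x @[n --> \oo] --> f x) ->
  int11 (F n) @[n --> \oo] --> int11 f.
Proof.
move=> mF mf Lk Fk Ff.
have [] := @dominated_convergence _ _ _ mu _ measurable11
  (fun n => EFin \o F n) (EFin \o f) (EFin \o k).
- by move=> n; apply/measurable_EFinP.
- exact/measurable_EFinP.
- by apply/aeW => x xI; apply: cvg_EFin; [exact: nearW|exact: Ff].
- exact: Lk.
- by apply/aeW => x n xI; rewrite /= lee_fin Fk.
move=> Lf _ cv.
have fin := integrable_fin_num (mu := mu) measurable11 Lf.
move: cv; rewrite -(fineK fin) => /fine_cvg; exact.
Qed.

End Integration.

(** * Continuously differentiable functions and a smooth ramp *)

Section Ramp.
Context {R : realType}.
Implicit Types f g u v : R -> R.

Definition C1 f f' := (forall x, is_derive x (1 : R) f (f' x)) /\ continuous f'.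

Lemma lipschitz_continuous (k : R) f :
  (forall x y, `|f x - f y| <= k * `|x - y|) -> continuous f.
Proof.
move=> fk x; apply/cvgrPdist_lt => e e0.
have k1 : 0 < `|k| + 1 by rewrite ltr_wpDl.
near=> y; apply: le_lt_trans (fk x y) _.
apply: (@le_lt_trans _ _ ((`|k| + 1) * `|x - y|)).
  by rewrite ler_wpM2r// (le_trans (ler_norm k))// lerDl.
rewrite mulrC -ltr_pdivlMr//; near: y.
by apply: cvgr_dist_lt => //; rewrite divr_gt0.
Unshelve. all: by end_near. Qed.

(** Proves derivability without a chain rule: for functions defined by cases
    the error bound reduces to polynomial inequalities. *)
Lemma quadratic_error_is_derive (C x l : R) f :
  (forall y, `|f y - f x - l * (y - x)| <= C * (y - x) ^+ 2) ->
  is_derive x (1 : R) f l.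
Proof.
move=> fC.
have cv : h^-1 *: (f (h *: (1 : R) + x) - f x) @[h --> 0^'] --> l.
  apply/cvgrPdist_lt => e e0.
  have k1 : 0 < `|C| + 1 by rewrite ltr_wpDl.
  near=> h.
  have h0 : h != 0 by near: h; exact: nbhs_dnbhs_neq.
  have -> : l - h^-1 *: (f (h *: (1 : R) + x) - f x) =
     - (h^-1 * (f (h + x) - f x - l * (h + x - x))).
    by rewrite /GRing.scale /= mulr1; field.
  rewrite normrN normrM normfV mulrC ltr_pdivrMr ?normr_gt0//.
  apply: le_lt_trans (fC _) _; rewrite addrK.
  rewrite -(real_normK (num_real h)) expr2 mulrA ltr_pM2r ?normr_gt0//.
  apply: (@le_lt_trans _ _ ((`|C| + 1) * `|h|)).
    by rewrite ler_wpM2r// (le_trans (ler_norm C))// lerDl.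
  rewrite mulrC -ltr_pdivlMr//; near: h.
  by apply: dnbhs0_lt; rewrite divr_gt0.
apply: DeriveDef; first by apply/cvg_ex; exists l.
exact: cvg_lim cv.
Unshelve. all: by end_near. Qed.

Definition clamp (a b x : R) := Num.max a (Num.min x b).

Lemma clamp_itv (a b x : R) : a <= b -> a <= clamp a b x <= b.
Proof. by move=> ab; rewrite /clamp le_max lexx /= ge_max ab ge_min lexx orbT. Qed.

Lemma clamp_id (a b x : R) : a <= x <= b -> clamp a b x = x.
Proof.
by move=> /andP[ax xb]; rewrite /clamp (min_idPl xb) (max_idPr ax).
Qed.

Lemma clamp_le (a b x : R) : a <= b -> x <= a -> clamp a b x = a.
Proof.
move=> ab xa; rewrite /clamp (min_idPl _) ?(le_trans xa)//.
by apply/max_idPl.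
Qed.

Lemma clamp_ge (a b x : R) : a <= b -> b <= x -> clamp a b x = b.
Proof. by move=> ab bx; rewrite /clamp (min_idPr bx); apply/max_idPr. Qed.

Lemma clamp_lipschitz (a b x y : R) : a <= b ->
  `|clamp a b x - clamp a b y| <= 1 * `|x - y|.
Proof.
move=> ab; rewrite mul1r.
have cases z : (z <= a /\ clamp a b z = a) \/ (b <= z /\ clamp a b z = b) \/
    (a <= z <= b /\ clamp a b z = z).
  have [za|az] := leP z a; first by left; rewrite clamp_le.
  have [bz|zb] := leP b z; first by right; left; rewrite clamp_ge.
  by right; right; rewrite !ltW// clamp_id// !ltW.
rewrite ler_norml; have := ler_norm (x - y); have := ler_norm (y - x).
rewrite -(distrC x); move: `|x - y| => d.
case: (cases x) => [[? ->]|[[? ->]|[/andP[? ?] ->]]];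
case: (cases y) => [[? ->]|[[? ->]|[/andP[? ?] ->]]]; lra.
Qed.

Lemma clamp_continuous (a b : R) : a <= b -> continuous (clamp a b).
Proof. by move=> ab; apply: (@lipschitz_continuous 1) => x y; exact: clamp_lipschitz. Qed.

(** The cubic with vanishing derivative at 0 and 1, so that clamping its
    argument leaves it continuously differentiable. *)
Definition ramp (x : R) := 3 * clamp 0 1 x ^+ 2 - 2 * clamp 0 1 x ^+ 3.
Definition dramp (x : R) := 6 * clamp 0 1 x * (1 - clamp 0 1 x).

Lemma ramp_le0 x : x <= 0 -> ramp x = 0.
Proof. by move=> x0; rewrite /ramp clamp_le//; ring. Qed.

Lemma ramp_ge1 x : 1 <= x -> ramp x = 1.
Proof. by move=> x0; rewrite /ramp clamp_ge//; ring. Qed.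

Lemma ramp01 x : 0 <= ramp x <= 1.
Proof.
rewrite /ramp; have /andP[] := clamp_itv x (@ler01 R); move: (clamp 0 1 x) => c c0 c1.
have c2 := sqr_ge0 c; have c3 := sqr_ge0 (1 - c).
rewrite -[X in _ && X]subr_ge0; apply/andP; split.
  rewrite (_ : _ - _ = c ^+ 2 * (3 - 2 * c)); last by ring.
  by apply: mulr_ge0 => //; lra.
rewrite (_ : _ - _ = (1 - c) ^+ 2 * (1 + 2 * c)); last by ring.
by apply: mulr_ge0 => //; lra.
Qed.

Lemma dramp_ge0 x : 0 <= dramp x.
Proof.
rewrite /dramp; have /andP[] := clamp_itv x (@ler01 R); move: (clamp 0 1 x) => c c0 c1.
by rewrite mulr_ge0//; lra.
Qed.

Lemma dramp_outside x : x <= 0 \/ 1 <= x -> dramp x = 0.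
Proof. by case=> h; rewrite /dramp ?(clamp_le _ h)// ?(clamp_ge _ h)//; ring. Qed.

(** The constant is half the maximum 6 of the absolute value of the second
    derivative on the unit interval. *)
Lemma ramp_quadratic_error x y :
  `|ramp y - ramp x - dramp x * (y - x)| <= 3 * (y - x) ^+ 2.
Proof.
have cases z : (z <= 0 /\ clamp 0 1 z = 0) \/ (1 <= z /\ clamp 0 1 z = 1) \/
    (0 <= z <= 1 /\ clamp 0 1 z = z).
  have [za|az] := leP z 0; first by left; rewrite clamp_le.
  have [bz|zb] := leP 1 z; first by right; left; rewrite clamp_ge.
  by right; right; rewrite !ltW// clamp_id// !ltW.
rewrite /ramp /dramp ler_norml; have dxy := sqr_ge0 (y - x).
case: (cases x) => [[hx ->]|[[hx ->]|[/andP[hx hx'] ->]]];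
case: (cases y) => [[hy ->]|[[hy ->]|[/andP[hy hy'] ->]]].
- by apply/andP; split; lra.
- by apply/andP; split; nra.
- by apply/andP; split; nra.
- by apply/andP; split; nra.
- by apply/andP; split; lra.
- have h1 : 0 <= (x - 1) * (1 - y) by rewrite mulr_ge0//; lra.
  have h2 : 0 <= (1 - y) ^+ 2 * y by rewrite mulr_ge0// sqr_ge0.
  have h3 : 0 <= (1 - y) ^+ 2 * (1 - y) by rewrite mulr_ge0// ?sqr_ge0//; lra.
  by apply/andP; split; nra.
- have h1 : 0 <= x ^+ 2 * x by rewrite mulr_ge0// sqr_ge0.
  have h2 : 0 <= x ^+ 2 * - y by rewrite mulr_ge0// ?sqr_ge0//; lra.
  have h3 : 0 <= x ^+ 2 * (1 - x) by rewrite mulr_ge0// ?sqr_ge0//; lra.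
  have h4 : 0 <= x * - y * (1 - x) by rewrite !mulr_ge0//; lra.
  have h5 := sqr_ge0 y.
  by apply/andP; split; nra.
- have h0 : 0 <= 1 - x by lra.
  have h1 : 0 <= (1 - x) ^+ 2 * (1 - x) by rewrite mulr_ge0// sqr_ge0.
  have h2 : 0 <= (1 - x) ^+ 2 * (y - 1) by rewrite mulr_ge0// ?sqr_ge0//; lra.
  have h3 : 0 <= (1 - x) ^+ 2 * x by rewrite mulr_ge0// ?sqr_ge0//; lra.
  have h4 : 0 <= (1 - x) * (y - 1) * x by rewrite !mulr_ge0//; lra.
  have h5 := sqr_ge0 (y - 1).
  by apply/andP; split; nra.
- have h1 : 0 <= (y - x) ^+ 2 * x by rewrite mulr_ge0// sqr_ge0.
  have h2 : 0 <= (y - x) ^+ 2 * y by rewrite mulr_ge0// sqr_ge0.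
  have h3 : 0 <= (y - x) ^+ 2 * (1 - x) by rewrite mulr_ge0// ?sqr_ge0//; lra.
  have h4 : 0 <= (y - x) ^+ 2 * (1 - y) by rewrite mulr_ge0// ?sqr_ge0//; lra.
  by apply/andP; split; lra.
Qed.

Lemma dramp_continuous : continuous dramp.
Proof.
have cc := clamp_continuous (@ler01 R).
move=> x; apply: cvgM; last by apply: cvgB; [exact: cvg_cst|exact: cc].
by apply: cvgM; [exact: cvg_cst|exact: cc].
Qed.

Lemma ramp_C1 (a h : R) : h != 0 ->
  C1 (fun x => ramp ((x - a) / h)) (fun x => dramp ((x - a) / h) / h).
Proof.
move=> h0; split=> [x|x].
  apply: (@quadratic_error_is_derive (3 / h ^+ 2)) => y.
  have := ramp_quadratic_error ((x - a) / h) ((y - a) / h).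
  congr (`| _ - _| <= _); first by field.
  by field.
apply: cvgM; last exact: cvg_cst.
apply: (@continuous_comp _ _ _ (fun x => (x - a) / h) dramp).
  by apply: cvgM; [apply: cvgB; [exact: cvg_id|exact: cvg_cst]|exact: cvg_cst].
exact: dramp_continuous.
Qed.

Lemma C1_continuous f f' : C1 f f' -> continuous f.
Proof.
move=> [df _] x; have [+ _] := df x.
by move=> /derivable1_diffP/differentiable_continuous.
Qed.

Lemma C1M f f' g g' : C1 f f' -> C1 g g' ->
  C1 (fun x => f x * g x) (fun x => f' x * g x + f x * g' x).
Proof.
move=> Cf Cg; have cf := C1_continuous Cf; have cg := C1_continuous Cg.
case: Cf Cg => df cf' [dg cg']; split=> [x|x].
  have := df x; have := dg x => ? ?.
  rewrite (_ : _ + _ = f x *: g' x + g x *: f' x); last first.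
    by rewrite addrC (mulrC (f' x)).
  exact: is_deriveM.
apply: cvgD; apply: cvgM; by [exact: cf|exact: cf'|exact: cg|exact: cg'].
Qed.

Lemma C1B f f' g g' : C1 f f' -> C1 g g' ->
  C1 (fun x => f x - g x) (fun x => f' x - g' x).
Proof.
move=> [df cf] [dg cg]; split=> [x|x]; last first.
  by apply: cvgB; [exact: cf|exact: cg].
have := df x; have := dg x => ? ?; exact: is_deriveB.
Qed.

Lemma C1D f f' g g' : C1 f f' -> C1 g g' ->
  C1 (fun x => f x + g x) (fun x => f' x + g' x).
Proof.
move=> [df cf] [dg cg]; split=> [x|x]; last first.
  by apply: cvgD; [exact: cf|exact: cg].
have := df x; have := dg x => ? ?; exact: is_deriveD.
Qed.

Lemma C1_cst (k : R) : C1 (fun=> k) (fun=> 0).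
Proof. by split=> [x|x]; [exact: is_derive_cst|exact: cvg_cst]. Qed.

Lemma C1_affine (a b : R) : C1 (fun x => a * (x + b)) (fun=> a).
Proof.
split=> x; last exact: cvg_cst.
apply: (@quadratic_error_is_derive 0) => y.
by rewrite -mulrBr -mulrBr (_ : _ - _ = 0) ?mulr0 ?normr0 ?mul0r//; ring.
Qed.

End Ramp.

(** * Integration by parts for weak derivatives *)

Section IntegrationByParts.
Context {R : realType}.
Implicit Types f g u v : R -> R.
Notation mu := (@lebesgue_measure R).
Notation I11 := (`[-1, 1]%classic : set R).

Lemma FTC2_C1 f f' : C1 f f' -> int11 f' = f 1 - f (-1).
Proof.
move=> Cf; have cf := C1_continuous Cf; case: Cf => df cf'.
have n11 : -1 < 1 :> R by lra.
rewrite /int11 /Rintegral (continuous_FTC2 (F := f) n11)//.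
- exact: cont11_continuous.
- split=> [x _||]; first by have [] := df x.
  + by apply: cvg_at_right_filter; exact: cf.
  + by apply: cvg_at_left_filter; exact: cf.
- by move=> x _; rewrite derive1E; have := df x; move=> ?; rewrite derive_val.
Qed.

Let bump (a h x : R) := dramp ((x - a) / h) / h.

Let bump_ge0 a h x : 0 < h -> 0 <= bump a h x.
Proof. by move=> h0; rewrite divr_ge0 ?dramp_ge0// ltW. Qed.

Let bump_cont a h : h != 0 -> continuous (bump a h).
Proof. by move=> h0; have [] := ramp_C1 a h0. Qed.

(** The derivative of a ramp is nonnegative and has integral 1, hence the
    integral of F against it is an average of the values of F on the ramp. *)
Lemma int11_bump F (a h y e : R) : cont11 F -> 0 < h -> -1 <= a -> a + h <= 1 ->
  (forall x, a <= x <= a + h -> `|F x - y| <= e) ->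
  `|int11 (fun x => F x * (dramp ((x - a) / h) / h)) - y| <= e.
Proof.
move=> cF h0 a1 ah Fe.
have hn0 : h != 0 by rewrite gt_eqF.
have cb : cont11 (bump a h) by apply: cont11_continuous; exact: bump_cont.
have ib : int11 (bump a h) = 1.
  rewrite (FTC2_C1 (ramp_C1 a hn0)) ramp_ge1 ?ramp_le0 ?subr0//.
    by rewrite pmulr_lle0 ?invr_gt0//; lra.
  by rewrite ler_pdivlMr//; lra.
have -> : y = int11 (fun x => y * bump a h x).
  by rewrite int11Z ?ib ?mulr1//; exact: cont11_L1.
have cyb : cont11 (fun x => y * bump a h x) by apply: cont11M => //; exact: cont11_cst.
have cFb : cont11 (fun x => F x * bump a h x) by apply: cont11M.
rewrite -int11B; [|exact: cont11_L1..].
have cD : cont11 (fun x => F x * bump a h x - y * bump a h x).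
  by apply: cont11D => //; exact: cont11N.
apply: le_trans (int11_norm (cont11_L1 cD)) _.
have -> : e = int11 (fun x => e * bump a h x).
  by rewrite int11Z ?ib ?mulr1//; exact: cont11_L1.
apply: int11_le.
- exact/L1_norm/cont11_L1.
- by apply/L1Z/cont11_L1.
- move=> x _; rewrite -mulrBl normrM (ger0_norm (bump_ge0 _ _ h0)).
  have [/andP[ax xa]|] := boolP (a <= x <= a + h).
    by rewrite ler_wpM2r ?bump_ge0// Fe// ax.
  rewrite negb_and -!ltNge => out; rewrite /bump dramp_outside ?mul0r ?mulr0//.
  case/orP: out => ?; [left|right].
    by rewrite pmulr_lle0 ?invr_gt0//; lra.
  by rewrite ler_pdivlMr//; lra.
Qed.

(** The derivatives of steeper and steeper ramps converge to a Dirac mass. *)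
Lemma int11_bump_cvg F (a h : nat -> R) (c : R) : cont11 F ->
  (forall n, 0 < h n) -> (forall n, -1 <= a n) -> (forall n, a n + h n <= 1) ->
  -1 <= c <= 1 -> a @ \oo --> c -> h @ \oo --> 0 ->
  int11 (fun x => F x * (dramp ((x - a n) / h n) / h n)) @[n --> \oo] --> F c.
Proof.
move=> cF h0 a1 ah c1 ac hc.
apply/cvgrPdist_le => e e0.
have /subspace_continuousP/(_ c) := cF.
move=> /(_ _)/cvgrPdist_le; rewrite /= in_itv/= => /(_ c1 e e0).
rewrite near_withinE => -[del /= del0 Fd].
have ac' : \forall n \near \oo, `|c - a n| < del / 2.
  by apply: cvgr_dist_lt => //; rewrite divr_gt0.
have hc' : \forall n \near \oo, `|0 - h n| < del / 2.
  by apply: cvgr_dist_lt => //; rewrite divr_gt0.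
near=> n; rewrite distrC; apply: int11_bump => // x /andP[ax xa].
rewrite distrC; apply: Fd => /=; last first.
  by rewrite in_itv/=; have := a1 n; have := ah n; lra.
have h1 : `|c - a n| < del / 2 by near: n.
have h2 : `|0 - h n| < del / 2 by near: n.
rewrite sub0r normrN gtr0_norm// in h2.
move: h1; rewrite !ltr_norml => /andP[h3 h4].
by apply/andP; split; lra.
Unshelve. all: by end_near. Qed.

(** Take as test function v times a cutoff that rises from 0 to 1 just after c
    and falls back just before d. In the limit of steep ramps the terms without
    derivative of the cutoff give the integral, by dominated convergence, and
    the two ramps give the boundary values. For v = 1 this is the fundamental
    theorem of calculus for u. *)
Lemma weak_ibp u g v v' (c d : R) : cont11 u -> is_weak_derivative u g ->
  C1 v v' -> -1 <= c -> c < d -> d <= 1 ->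
  \int[mu]_(x in `[c, d]) (u x * v' x + g x * v x) = u d * v d - u c * v c.
Proof.
move=> cu [g2 gu] Cv c1 cd d1.
(* The ramps occupy `[c + h, c + 2 h] and `[d - 2 h, d - h]: they stay off the
   ends, so the support is compact, and a quarter of the length keeps them
   disjoint. *)
pose h (n : nat) : R := (d - c) / 4 * n.+1%:R^-1.
have h0 n : 0 < h n by rewrite mulr_gt0 ?divr_gt0 ?invr_gt0//; lra.
have hd n : 4 * h n <= d - c.
  rewrite /h mulrA mulrC -[leRHS]mul1r; apply: ler_pM; rewrite ?invr_ge0//; try lra.
  by rewrite invf_le1// ler1n.
have hc : h @ \oo --> 0.
  rewrite -[X in _ --> X](mulr0 ((d - c) / 4)).
  by apply: cvgM; [exact: cvg_cst|exact: cvg_harmonic].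
have hn0 n : h n != 0 by rewrite gt_eqF.
pose a n := c + h n; pose b n := d - 2 * h n.
pose rho n x := ramp ((x - a n) / h n); pose drho n x := dramp ((x - a n) / h n) / h n.
pose sig n x := ramp ((x - b n) / h n); pose dsig n x := dramp ((x - b n) / h n) / h n.
have Ceta n : C1 (fun x => rho n x - sig n x) (fun x => drho n x - dsig n x).
  by apply: C1B; exact: ramp_C1.
have cv := C1_continuous Cv.
have cuv : cont11 (fun x => u x * v x).
  by apply: cont11M => //; exact: cont11_continuous.
have LK : L1 (fun x => u x * v' x + g x * v x).
  apply: L1D.
    apply/cont11_L1/cont11M => //; apply: cont11_continuous; by case: Cv.
  by apply: L2_mul => //; apply/cont11_L2/cont11_continuous.
pose K x := u x * v' x + g x * v x.
have etale n x : `|rho n x - sig n x| <= 1.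
  have := ramp01 ((x - a n) / h n); have := ramp01 ((x - b n) / h n).
  rewrite -/(rho n x) -/(sig n x) => /andP[? ?] /andP[? ?].
  by rewrite ler_norml; apply/andP; split; lra.
have meta n : cont11 (fun x => rho n x - sig n x).
  by apply: cont11_continuous; exact: C1_continuous (Ceta n).
have key n : int11 (fun x => K x * (rho n x - sig n x)) =
    int11 (fun x => (u x * v x) * dsig n x) - int11 (fun x => (u x * v x) * drho n x).
  have Cphi := C1M Cv (Ceta n).
  pose phi x := v x * (rho n x - sig n x).
  have dphi : derive1 phi =
      (fun x => v' x * (rho n x - sig n x) + v x * (drho n x - dsig n x)).
    apply/funext => x; case: Cphi => /(_ x) ? _.
    by rewrite derive1E derive_val.
  have tphi : test_function phi.
    split.
    - by move=> x; case: Cphi => /(_ x)[].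
    - by rewrite dphi; case: Cphi.
    - exists (a n), (d - h n); split.
      + by rewrite /a; have := h0 n; lra.
      + by have := h0 n; lra.
      + move=> x; rewrite in_itv/= negb_and -!ltNge => out.
        rewrite /phi /rho /sig /a /b.
        have := h0 n; have := hd n => hd0 hh0.
        case/orP: out => hx.
          rewrite ramp_le0; last by rewrite pmulr_lle0 ?invr_gt0//; rewrite /a in hx; lra.
          rewrite ramp_le0; last by rewrite pmulr_lle0 ?invr_gt0//; rewrite /a in hx; lra.
          by rewrite subr0 mulr0.
        rewrite ramp_ge1; last by rewrite ler_pdivlMr//; lra.
        rewrite ramp_ge1; last by rewrite ler_pdivlMr//; lra.
        by rewrite subrr mulr0.
  have := gu _ tphi; rewrite dphi -!/(int11 _) /phi => E.
  have cd1 : cont11 (fun x => u x * v x * dsig n x).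
    apply: cont11M => //; apply: cont11_continuous.
    by case: (ramp_C1 (b n) (hn0 n)).
  have cd2 : cont11 (fun x => u x * v x * drho n x).
    apply: cont11M => //; apply: cont11_continuous.
    by case: (ramp_C1 (a n) (hn0 n)).
  have cve : cont11 (fun x => v x * (rho n x - sig n x)).
    by apply: cont11M => //; exact: cont11_continuous.
  have L3 : L1 (fun x => g x * (v x * (rho n x - sig n x))).
    by apply: L2_mul => //; exact: cont11_L2.
  have L4 : L1 (fun x => u x * v' x * (rho n x - sig n x)).
    apply: cont11_L1; apply: cont11M => //; apply: cont11M => //.
    by apply: cont11_continuous; case: Cv.
  have L1a : L1 (fun x => u x * v x * drho n x - u x * v x * dsig n x).
    by apply: L1B; exact: cont11_L1.
  have E1 : int11 (fun x => u x * (v' x * (rho n x - sig n x) + v x * (drho n x - dsig n x)))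
    = int11 (fun x => u x * v' x * (rho n x - sig n x)) +
      (int11 (fun x => u x * v x * drho n x) - int11 (fun x => u x * v x * dsig n x)).
    rewrite -int11B; [|exact: cont11_L1..].
    by rewrite -int11D//; apply: int11_ext => x _; ring.
  have E2 : int11 (fun x => K x * (rho n x - sig n x)) =
     int11 (fun x => u x * v' x * (rho n x - sig n x)) +
     int11 (fun x => g x * (v x * (rho n x - sig n x))).
    by rewrite -int11D//; apply: int11_ext => x _; rewrite /K; ring.
  move: E; rewrite E1 E2; lra.
have cvR : int11 (fun x => K x * (rho n x - sig n x)) @[n --> \oo] -->
    u d * v d - u c * v c.
  under eq_fun do rewrite key.
  apply: cvgB.
    apply: (int11_bump_cvg (F := fun x => u x * v x)) => //.
    - by move=> n; rewrite /b; have := hd n; have := h0 n; lra.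
    - by move=> n; rewrite /b; have := hd n; have := h0 n; lra.
    - by apply/andP; split; lra.
    - rewrite -[X in _ --> X]subr0 -[X in _ - X](mulr0 2).
      by apply: cvgB; [exact: cvg_cst|apply: cvgM; [exact: cvg_cst|exact: hc]].
  apply: (int11_bump_cvg (F := fun x => u x * v x)) => //.
  - by move=> n; rewrite /a; have := hd n; have := h0 n; lra.
  - by move=> n; rewrite /a; have := hd n; have := h0 n; lra.
  - by apply/andP; split; lra.
  - rewrite -[X in _ --> X]addr0.
    by apply: cvgD; [exact: cvg_cst|exact: hc].
have sub : `]c, d[ `<=` I11.
  by move=> x; rewrite /= !in_itv/= => /andP[? ?]; apply/andP; split; lra.
have LKcd : mu.-integrable `[c, d] (EFin \o K).
  apply: (integrableS measurable11 (measurable_itv _) _ LK).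
  by move=> x; rewrite /= !in_itv/= => /andP[? ?]; apply/andP; split; lra.
have IIcd : I11 `&` `]c, d[%classic = `]c, d[%classic :> set R by apply: setIidr.
have LKo : mu.-integrable `]c, d[ (EFin \o K).
  exact: (integrableS measurable11 (measurable_itv _) sub LK).
have LKr : L1 (K \_ `]c, d[).
  rewrite /L1 -restrict_EFin; apply/(integrable_restrict mu _ measurable11).
    exact: measurable_itv.
  by rewrite IIcd.
have cvL : int11 (fun x => K x * (rho n x - sig n x)) @[n --> \oo] -->
    int11 (K \_ `]c, d[).
  apply: (@int11_dominated _ _ _ (fun x => `|K x|)).
  - move=> n; apply: measurable_funM; first exact: L1_measurable.
    exact: cont11_measurable.
  - exact: L1_measurable.
  - exact: L1_norm.
  - by move=> n x _; rewrite normrM ler_piMr.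
  - move=> x xI; apply: cvg_near_cst; rewrite patchE.
    case: ifPn => [|].
      rewrite inE /= in_itv/= => /andP[cx xd].
      have n1 : \forall n \near \oo, `|0 - h n| < (x - c) / 2.
        by apply: cvgr_dist_lt => //; lra.
      have n2 : \forall n \near \oo, `|0 - h n| < (d - x) / 2.
        by apply: cvgr_dist_lt => //; lra.
      near=> n.
      have h1 : `|0 - h n| < (x - c) / 2 by near: n.
      have h2 : `|0 - h n| < (d - x) / 2 by near: n.
      rewrite sub0r normrN gtr0_norm// in h1.
      rewrite sub0r normrN gtr0_norm// in h2.
      rewrite /rho /sig ramp_ge1; last by rewrite ler_pdivlMr// /a; lra.
      rewrite ramp_le0 ?subr0 ?mulr1// pmulr_lle0 ?invr_gt0// /b; lra.
    rewrite notin_setE /= in_itv/= => /negP; rewrite negb_and -!leNgt => out.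
    apply: nearW => n; have := h0 n; have := hd n => hdn h0n.
    case/orP: out => hx.
      rewrite /rho /sig !ramp_le0 ?subr0 ?mulr0//;
        by rewrite pmulr_lle0 ?invr_gt0// /a /b; lra.
    rewrite /rho /sig !ramp_ge1 ?subrr ?mulr0//;
      by rewrite ler_pdivlMr// /a /b; lra.
rewrite -(cvg_unique _ cvL cvR)//.
rewrite /int11 -Rintegral_mkcondr IIcd.
rewrite -Rintegral_itv_obnd_cbnd; last first.
  by apply: (integrableS _ _ _ LKcd) => //; apply: subset_itvr; rewrite bnd_simp.
by rewrite Rintegral_itv_bndo_bndc.
Unshelve. all: by end_near. Qed.

End IntegrationByParts.

(** * Weak derivatives *)

Section WeakDerivatives.
Context {R : realType}.
Implicit Types f g u v : R -> R.
Notation mu := (@lebesgue_measure R).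
Notation I11 := (`[-1, 1]%classic : set R).

Lemma weak_derivative_spec u : H1 u -> is_weak_derivative u (weak_derivative u).
Proof. by move=> [_ _ [g ug]]; exact: (@xgetI _ _ _ g). Qed.

Lemma weak_derivative_primitive u g (c d : R) : cont11 u -> is_weak_derivative u g ->
  -1 <= c -> c <= d -> d <= 1 -> \int[mu]_(x in `[c, d]) g x = u d - u c.
Proof.
move=> cu ug c1; rewrite le_eqVlt => /predU1P[<- _|cd d1].
  by rewrite subrr set_itv1 Rintegral_set1.
have := weak_ibp cu ug (C1_cst 1) c1 cd d1; rewrite !mulr1 => <-.
by apply: eq_Rintegral => x _; rewrite mulr0 add0r mulr1.
Qed.

Lemma L1_restrict f (A : set R) : measurable (A : set (measurableTypeR R)) ->
  L1 f -> mu.-integrable A (EFin \o (f \_ I11)).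
Proof.
move=> mA Lf; rewrite -restrict_EFin; apply/(integrable_restrict mu measurable11 mA).
apply: (integrableS measurable11 _ _ Lf); last by move=> ? [].
exact: measurableI mA measurable11.
Qed.

(** By the Lebesgue differentiation theorem, f is almost everywhere the
    derivative of its primitive. *)
Lemma ae0_of_primitive f : L1 f ->
  (forall x, -1 <= x <= 1 -> \int[mu]_(t in `[-1, x]) f t = 0) ->
  {ae mu, forall x, I11 x -> f x = 0}.
Proof.
move=> Lf f0.
have F0 y : \int[mu]_(t in `]-oo, y]) (f \_ I11) t = 0.
  rewrite -Rintegral_mkcondr.
  have [ylt|yge] := ltP y (-1).
    rewrite (_ : _ `&` _ = set0) ?Rintegral_set0//.
    apply/seteqP; split=> // x [] /=; rewrite !in_itv/= => xy /andP[x1 _].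
    by have := le_lt_trans x1 (le_lt_trans xy ylt); rewrite ltxx.
  rewrite (_ : _ `&` _ = `[-1, Num.min y 1]%classic).
    by rewrite f0// le_min yge ge_min lexx orbT !andbT; lra.
  apply/seteqP; split=> x /=; rewrite !in_itv/= le_min.
    by move=> [-> /andP[-> ->]].
  by move=> /andP[-> /andP[-> ->]].
have := @FTC1Ny R (f \_ I11) _ _.
have int_y y : mu.-integrable `]-oo, y] (EFin \o (f \_ I11)).
  exact: L1_restrict.
have loc : locally_integrable setT (f \_ I11).
  by apply: integrable_locally; [exact: measurable11|exact: Lf].
move=> /(_ int_y loc) /=; apply: filterS; first exact: (ae_filter_ringOfSetsType mu).
move=> x [_ +] xI.
rewrite (_ : (fun y => _) = cst 0); last exact/funext.
by rewrite derive1_cst patchE mem_set.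
Qed.

(** Two weak derivatives of u have the same primitive. *)
Lemma weak_derivative_unique u g1 g2 : cont11 u ->
  is_weak_derivative u g1 -> is_weak_derivative u g2 ->
  {ae mu, forall x, I11 x -> g1 x = g2 x}.
Proof.
move=> cu ug1 ug2.
have Lg1 := L2_L1 ug1.1; have Lg2 := L2_L1 ug2.1.
have := @ae0_of_primitive (fun x => g1 x - g2 x) (L1B Lg1 Lg2).
have sub x : -1 <= x <= 1 -> `[-1, x] `<=` I11.
  move=> /andP[_ x1] y; rewrite /= !in_itv/= => /andP[-> yx]; exact: le_trans yx x1.
move=> h; have : {ae mu, forall x, I11 x -> g1 x - g2 x = 0}.
  apply: h => x x1; have /andP[x1' x1''] := x1.
  have mx : measurable (`[-1, x]%classic : set (measurableTypeR R)) by exact: measurable_itv.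
  rewrite RintegralB; [|exact: mx|exact: (integrableS measurable11 mx (sub _ x1) Lg1)
                        |exact: (integrableS measurable11 mx (sub _ x1) Lg2)].
  by rewrite !(weak_derivative_primitive cu)// subrr.
apply: filterS; first exact: (ae_filter_ringOfSetsType mu).
by move=> x hx xI; apply/eqP; rewrite -subr_eq0; apply/eqP; exact: hx.
Qed.

Lemma test_functionC1 (phi : R -> R) : test_function phi ->
  [/\ C1 phi (derive1 phi), phi (-1) = 0 & phi 1 = 0].
Proof.
move=> [dphi cphi [a [b [a1 b1 phi0]]]]; split.
- split=> [x|//]; rewrite derive1E; exact: derivableP.
- by rewrite phi0// in_itv/=; apply/negP => /andP[? ?]; lra.
- by rewrite phi0// in_itv/=; apply/negP => /andP[? ?]; lra.
Qed.

Lemma is_weak_derivativeDZ (k : R) u v g h : cont11 u -> cont11 v ->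
  is_weak_derivative u g -> is_weak_derivative v h ->
  is_weak_derivative (fun x => u x + k * v x) (fun x => g x + k * h x).
Proof.
move=> cu cv [g2 ug] [h2 vh]; split; first by apply: L2D => //; exact: L2Z.
move=> phi tphi; have [Cphi _ _] := test_functionC1 tphi.
have cphi : cont11 phi by apply: cont11_continuous; exact: C1_continuous Cphi.
have cphi' : cont11 (derive1 phi) by apply: cont11_continuous; case: Cphi.
have := ug _ tphi; have := vh _ tphi; rewrite -!/(int11 _) => E1 E2.
transitivity (int11 (fun x => u x * derive1 phi x)
    + k * int11 (fun x => v x * derive1 phi x)).
  have L := cont11_L1 (cont11M cv cphi').
  rewrite -int11Z// -int11D; [|exact/cont11_L1/cont11M|exact: L1Z].
  by apply: int11_ext => x _; ring.
rewrite E1 E2.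
have Lg : L1 (fun x => g x * phi x) by apply: L2_mul => //; exact: cont11_L2.
have Lh : L1 (fun x => h x * phi x) by apply: L2_mul => //; exact: cont11_L2.
rewrite mulrN -opprD -int11Z// -int11D//; last exact: L1Z.
by congr (- _); apply: int11_ext => x _; ring.
Qed.

Lemma C1_weak_derivative u u' : C1 u u' -> is_weak_derivative u u'.
Proof.
move=> Cu; have [_ cu'] := Cu.
have cu'1 := cont11_continuous cu'; have cu1 := cont11_continuous (C1_continuous Cu).
split; first exact: cont11_L2.
move=> phi /test_functionC1[Cphi pm p1].
have := FTC2_C1 (C1M Cu Cphi); rewrite pm p1 !mulr0 subrr.
have cphi : cont11 phi by apply: cont11_continuous; exact: C1_continuous Cphi.
have cphi' : cont11 (derive1 phi) by apply: cont11_continuous; case: Cphi.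
rewrite int11D; [|exact/cont11_L1/cont11M..].
by rewrite -!/(int11 _) => /eqP; rewrite addrC addr_eq0 => /eqP.
Qed.

Lemma C1_H1 u u' : C1 u u' -> H1 u.
Proof.
move=> Cu; have cu := cont11_continuous (C1_continuous Cu).
by split=> //; [exact: cont11_L2|exists u'; exact: C1_weak_derivative].
Qed.

Lemma H1DZ (k : R) u v : H1 u -> H1 v -> H1 (fun x => u x + k * v x).
Proof.
move=> [cu u2 [g ug]] [cv v2 [h vh]]; split.
- by apply: cont11D => //; apply: cont11M => //; exact: cont11_cst.
- by apply: L2D => //; exact: L2Z.
- by exists (fun x => g x + k * h x); exact: is_weak_derivativeDZ.
Qed.

(** The Cauchy-Schwarz bound for the primitive of g, obtained by integrating the
    square of g minus a constant. *)
Lemma poincare u g : cont11 u -> is_weak_derivative u g -> u (-1) = 0 ->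
  forall x, -1 <= x <= 1 -> u x ^+ 2 <= 2 * int11 (fun y => g y ^+ 2).
Proof.
move=> cu ug u0 x /andP[x1 x1'].
have [[mg g2] _] := ug; have Lg := L2_L1 ug.1.
have mx : measurable (`[-1, x]%classic : set (measurableTypeR R)) by exact: measurable_itv.
have sub : `[-1, x] `<=` I11.
  by move=> y; rewrite /= !in_itv/= => /andP[-> yx]; exact: le_trans yx x1'.
have ix : \int[mu]_(y in `[-1, x]) g y = u x.
  by rewrite (weak_derivative_primitive cu)// u0 subr0.
have LgX := integrableS measurable11 mx sub Lg.
have Lg2 := integrableS measurable11 mx sub g2.
(* The constant u x / 2 is the mean of g on `[-1, x] when x = 1; for shorter
   intervals it still gives the bound, because x + 1 <= 2. *)
have h0 : 0 <= \int[mu]_(y in `[-1, x]) (g y - u x / 2) ^+ 2.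
  by apply: Rintegral_ge0 => y _; exact: sqr_ge0.
have cx : mu.-integrable `[-1, x] (EFin \o cst ((u x / 2) ^+ 2)).
  apply: (integrableS measurable11 mx sub); apply: cont11_L1; exact: cont11_cst.
have Lz : mu.-integrable `[-1, x] (EFin \o (fun y => u x * g y)).
  by apply: (integrableS measurable11 mx sub); exact: L1Z.
have Eq : \int[mu]_(y in `[-1, x]) (g y - u x / 2) ^+ 2 =
    \int[mu]_(y in `[-1, x]) (g y ^+ 2) - u x * u x + (x + 1) * (u x / 2) ^+ 2.
  rewrite -[X in _ - _ * X]ix -RintegralZl//.
  have -> : (x + 1) * (u x / 2) ^+ 2 = \int[mu]_(y in `[-1, x]) ((u x / 2) ^+ 2).
    rewrite Rintegral_cst// mulrC; congr (_ * _).
    have : mu `[-1, x] = (x + 1)%:E.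
      rewrite lebesgue_measure_itv/= lte_fin; case: ltP => h.
        by congr EFin; lra.
      by congr EFin; lra.
    by move=> /(congr1 fine) ->.
  rewrite -RintegralB// -RintegralD//; last first.
    exact: (integrableB mx Lg2 Lz).
  by apply: eq_Rintegral => y _; field.
have le2 : \int[mu]_(y in `[-1, x]) (g y ^+ 2) <= int11 (fun y => g y ^+ 2).
  rewrite /int11 [leRHS](_ : _ = \int[mu]_(y in `[-1, x]) (g y ^+ 2) +
     \int[mu]_(y in `]x, 1]) (g y ^+ 2)).
    by rewrite lerDl; apply: Rintegral_ge0 => y _; exact: sqr_ge0.
  have := @Rintegral_itvB R (fun y => g y ^+ 2) (BLeft (-1)) (BRight 1) x g2.
  rewrite !bnd_simp => /(_ x1 x1') <-.
  by rewrite addrC subrK.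
have := sqr_ge0 (u x); move: h0 le2; rewrite Eq.
move: (int11 _) (Rintegral _ _ _) => A B; nra.
Qed.

End WeakDerivatives.

(** * First variation of the energy *)

(** Splits the continuity of a polynomial expression along its syntax; plain
    application of the closure lemmas would unfold the ring operations. *)
Ltac cont_poly := repeat lazymatch goal with
  | |- cont11 (fun x => @?f x + @?g x) => refine (@cont11D _ f g _ _); cbv beta
  | |- cont11 (fun x => @?f x * @?g x) => refine (@cont11M _ f g _ _); cbv beta
  | |- cont11 (fun x => @?f x ^+ ?n) => refine (@cont11X _ f n _); cbv beta
  | |- cont11 (fun x => - @?f x) => refine (@cont11N _ f _); cbv beta
  | |- cont11 (fun x => ?f x) => change (cont11 f); assumption
  | |- cont11 (fun x => ?k) => exact (@cont11_cst _ k)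
  end.

Section FirstVariation.
Context {R : realType}.
Variables theta lambda : R.
Notation mu := (@lebesgue_measure R).
Notation I11 := (`[-1, 1]%classic : set R).
Implicit Types Q P : R -> R * R * R.

(** Half of the squared norm of the matrix with these components, and the
    associated inner product [wdot]. *)
Definition wnorm (a b c : R) := 3 * a ^+ 2 + b ^+ 2 + c ^+ 2.
Definition wdot (a b c a' b' c' : R) := 3 * (a * a') + b * b' + c * c'.

Definition bulk_poly (a b c : R) :=
  theta / 3 * wnorm a b c + 4 * a * (a ^+ 2 - b ^+ 2 - c ^+ 2)
  + 1 / 2 * wnorm a b c ^+ 2 + bulk_const theta.

Lemma bulkE (v : R * R * R) :
  bulk theta (Qmx v) = bulk_poly (q1 v) (q2 v) (q3 v).
Proof. by rewrite /bulk bulk0E. Qed.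

Definition dbulk1 (a b c : R) :=
  2 * theta * a + 4 * (3 * a ^+ 2 - b ^+ 2 - c ^+ 2) + 6 * a * wnorm a b c.
Definition dbulk2 (a b c : R) :=
  2 * theta / 3 * b - 8 * a * b + 2 * b * wnorm a b c.
Definition dbulk3 (a b c : R) :=
  2 * theta / 3 * c - 8 * a * c + 2 * c * wnorm a b c.

(** The coefficients of the Taylor expansion of the bulk potential at (a, b, c)
    in the direction (a', b', c'); the linear one is the directional
    derivative. *)
Definition bulk_poly1 (a b c a' b' c' : R) :=
  dbulk1 a b c * a' + dbulk2 a b c * b' + dbulk3 a b c * c'.
Definition bulk_poly2 (a b c a' b' c' : R) :=
  theta / 3 * wnorm a' b' c' + 4 * (a * (3 * a' ^+ 2 - b' ^+ 2 - c' ^+ 2)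
      - 2 * b * a' * b' - 2 * c * a' * c')
  + 2 * wdot a b c a' b' c' ^+ 2 + wnorm a b c * wnorm a' b' c'.
Definition bulk_poly3 (a b c a' b' c' : R) :=
  4 * a' * (a' ^+ 2 - b' ^+ 2 - c' ^+ 2) + 2 * wdot a b c a' b' c' * wnorm a' b' c'.
Definition bulk_poly4 (a' b' c' : R) := 1 / 2 * wnorm a' b' c' ^+ 2.

Lemma bulk_taylor (a b c a' b' c' t : R) :
  bulk_poly (a + t * a') (b + t * b') (c + t * c') =
  bulk_poly a b c + t * bulk_poly1 a b c a' b' c' + t ^+ 2 * bulk_poly2 a b c a' b' c'
  + t ^+ 3 * bulk_poly3 a b c a' b' c' + t ^+ 4 * bulk_poly4 a' b' c'.
Proof.
rewrite /bulk_poly /bulk_poly1 /bulk_poly2 /bulk_poly3 /bulk_poly4 /dbulk1 /dbulk2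
  /dbulk3 /wdot /wnorm; move: (bulk_const theta) => k; by field.
Qed.

Lemma cont11_bulk_poly (a b c a' b' c' : R -> R) :
  cont11 a -> cont11 b -> cont11 c -> cont11 a' -> cont11 b' -> cont11 c' ->
  [/\ cont11 (fun x => bulk_poly (a x) (b x) (c x)),
      cont11 (fun x => bulk_poly1 (a x) (b x) (c x) (a' x) (b' x) (c' x)),
      cont11 (fun x => bulk_poly2 (a x) (b x) (c x) (a' x) (b' x) (c' x)),
      cont11 (fun x => bulk_poly3 (a x) (b x) (c x) (a' x) (b' x) (c' x)) &
      cont11 (fun x => bulk_poly4 (a' x) (b' x) (c' x))].
Proof.
move=> *; rewrite /bulk_poly /bulk_poly1 /bulk_poly2 /bulk_poly3 /bulk_poly4 /dbulk1
  /dbulk2 /dbulk3 /wdot /wnorm; split; cont_poly.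
Qed.

Definition first_variation Q P : R :=
  int11 (fun x => 2 / lambda ^+ 2 *
    wdot (weak_derivative (@q1 R \o Q) x) (weak_derivative (@q2 R \o Q) x)
         (weak_derivative (@q3 R \o Q) x) (weak_derivative (@q1 R \o P) x)
         (weak_derivative (@q2 R \o P) x) (weak_derivative (@q3 R \o P) x)
    + bulk_poly1 (q1 (Q x)) (q2 (Q x)) (q3 (Q x)) (q1 (P x)) (q2 (P x)) (q3 (P x))).

Lemma int11_ae (f g : R -> R) :
  measurable_fun (I11 : set (measurableTypeR R)) f ->
  measurable_fun (I11 : set (measurableTypeR R)) g ->
  {ae mu, forall x, I11 x -> f x = g x} -> int11 f = int11 g.
Proof.
move=> mf mg fg; congr fine; apply: ae_eq_integral.
- exact: measurable11.
- exact/measurable_EFinP.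
- exact/measurable_EFinP.
- apply: filterS fg; first exact: (ae_filter_ringOfSetsType mu).
  by move=> x fg xI; rewrite fg.
Qed.

Lemma L1_wdot (f1 f2 f3 g1 g2 g3 : R -> R) :
  square_integrable f1 -> square_integrable f2 -> square_integrable f3 ->
  square_integrable g1 -> square_integrable g2 -> square_integrable g3 ->
  L1 (fun x => wdot (f1 x) (f2 x) (f3 x) (g1 x) (g2 x) (g3 x)).
Proof.
move=> *; apply: L1D; last exact: L2_mul.
by apply: L1D; [apply: L1Z; exact: L2_mul|exact: L2_mul].
Qed.

(** The energy is defined with one chosen weak derivative; the integral does not
    depend on the choice, which makes it computable along a line. *)
Lemma energyE Q (g1 g2 g3 : R -> R) : H1_3 Q ->
  is_weak_derivative (@q1 R \o Q) g1 -> is_weak_derivative (@q2 R \o Q) g2 ->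
  is_weak_derivative (@q3 R \o Q) g3 ->
  energy theta lambda Q = int11 (fun x =>
    1 / lambda ^+ 2 * wdot (g1 x) (g2 x) (g3 x) (g1 x) (g2 x) (g3 x)
    + bulk_poly (q1 (Q x)) (q2 (Q x)) (q3 (Q x))).
Proof.
move=> [H1' H2 H3] D1 D2 D3.
have D1' := weak_derivative_spec H1'; have D2' := weak_derivative_spec H2.
have D3' := weak_derivative_spec H3.
case: H1' H2 H3 => c1 _ _ [c2 _ _] [c3 _ _].
have [mb _ _ _ _] := cont11_bulk_poly c1 c2 c3 c1 c2 c3.
have mg (h1 h2 h3 : R -> R) k : square_integrable h1 -> square_integrable h2 ->
    square_integrable h3 ->
    measurable_fun (I11 : set (measurableTypeR R)) (fun x =>
      k * wdot (h1 x) (h2 x) (h3 x) (h1 x) (h2 x) (h3 x)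
      + bulk_poly (q1 (Q x)) (q2 (Q x)) (q3 (Q x))).
  move=> ? ? ?; apply: L1_measurable; apply: L1D; last exact: cont11_L1.
  by apply: L1Z; exact: L1_wdot.
transitivity (int11 (fun x => 1 / lambda ^+ 2 *
  wdot (weak_derivative (@q1 R \o Q) x) (weak_derivative (@q2 R \o Q) x)
    (weak_derivative (@q3 R \o Q) x) (weak_derivative (@q1 R \o Q) x)
    (weak_derivative (@q2 R \o Q) x) (weak_derivative (@q3 R \o Q) x)
  + bulk_poly (q1 (Q x)) (q2 (Q x)) (q3 (Q x)))).
  rewrite /energy -/(int11 _); apply: int11_ext => x _.
  rewrite sqnormE bulkE /wdot /weak_derivative3 /q1 /q2 /q3 /= -!expr2.
  congr (_ + _); rewrite mulrA; congr (_ * _).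
  by rewrite invfM !mul1r mulrC mulrA divff ?mul1r ?pnatr_eq0.
apply: int11_ae.
- by apply: mg; [case: D1'|case: D2'|case: D3'].
- by apply: mg; [case: D1|case: D2|case: D3].
have E1 := weak_derivative_unique c1 D1' D1.
have E2 := weak_derivative_unique c2 D2' D2.
have E3 := weak_derivative_unique c3 D3' D3.
have aeF := ae_filter_ringOfSetsType mu.
apply: filterS3 E1 E2 E3 => x e1 e2 e3 xI.
by rewrite e1// e2// e3.
Qed.

(** The integrand at Q + t P is a polynomial of degree 4 in t with integrable
    coefficients, so the energy is a polynomial in t. *)
Lemma energy_first_variation Q P : H1_3 Q -> H1_3 P ->
  is_derive (0 : R) (1 : R) (fun t : R => energy theta lambda (Q + t *: P))
    (first_variation Q P).
Proof.
move=> HQ HP.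
have [HQ1 HQ2 HQ3] := HQ; have [HP1 HP2 HP3] := HP.
have DQ1 := weak_derivative_spec HQ1; have DP1 := weak_derivative_spec HP1.
have DQ2 := weak_derivative_spec HQ2; have DP2 := weak_derivative_spec HP2.
have DQ3 := weak_derivative_spec HQ3; have DP3 := weak_derivative_spec HP3.
have [cQ1 _ _] := HQ1; have [cQ2 _ _] := HQ2; have [cQ3 _ _] := HQ3.
have [cP1 _ _] := HP1; have [cP2 _ _] := HP2; have [cP3 _ _] := HP3.
have sQ1 := DQ1.1; have sQ2 := DQ2.1; have sQ3 := DQ3.1.
have sP1 := DP1.1; have sP2 := DP2.1; have sP3 := DP3.1.
have [cb0 cb1 cb2 cb3 cb4] := cont11_bulk_poly cQ1 cQ2 cQ3 cP1 cP2 cP3.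
have LK0 := L1Z (1 / lambda ^+ 2) (L1_wdot sQ1 sQ2 sQ3 sQ1 sQ2 sQ3).
have LK1 := L1Z (2 / lambda ^+ 2) (L1_wdot sQ1 sQ2 sQ3 sP1 sP2 sP3).
have LK2 := L1Z (1 / lambda ^+ 2) (L1_wdot sP1 sP2 sP3 sP1 sP2 sP3).
have LA0 := L1D LK0 (cont11_L1 cb0); have LA1 := L1D LK1 (cont11_L1 cb1).
have LA2 := L1D LK2 (cont11_L1 cb2); have LA3 := cont11_L1 cb3.
have LA4 := cont11_L1 cb4.
have [E0 [E2 [E3 [E4 E]]]] : exists E0 E2 E3 E4, forall t,
    energy theta lambda (Q + t *: P) = E0 + t * first_variation Q P
      + t ^+ 2 * E2 + t ^+ 3 * E3 + t ^+ 4 * E4.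
  pose I (f : R -> R) (_ : L1 f) := int11 f.
  exists (I _ LA0), (I _ LA2), (I _ LA3), (I _ LA4) => t; rewrite /I {I}.
  have D1 := is_weak_derivativeDZ t cQ1 cP1 DQ1 DP1.
  have D2 := is_weak_derivativeDZ t cQ2 cP2 DQ2 DP2.
  have D3 := is_weak_derivativeDZ t cQ3 cP3 DQ3 DP3.
  have HQP : H1_3 (Q + t *: P) by split; exact: H1DZ.
  rewrite (@energyE (Q + t *: P) _ _ _ HQP D1 D2 D3) /first_variation.
  rewrite -(int11Z t LA1).
  have LB1 := L1D LA0 (L1Z t LA1).
  have LB2 := L1D LB1 (L1Z (t ^+ 2) LA2).
  have LB3 := L1D LB2 (L1Z (t ^+ 3) LA3).
  rewrite -(int11D LA0 (L1Z t LA1)).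
  rewrite -(int11Z (t ^+ 2) LA2) -(int11D LB1 (L1Z _ LA2)).
  rewrite -(int11Z (t ^+ 3) LA3) -(int11D LB2 (L1Z _ LA3)).
  rewrite -(int11Z (t ^+ 4) LA4) -(int11D LB3 (L1Z _ LA4)).
  apply: int11_ext => x _.
  rewrite (_ : q1 ((Q + t *: P) x) = q1 (Q x) + t * q1 (P x))//.
  rewrite (_ : q2 ((Q + t *: P) x) = q2 (Q x) + t * q2 (P x))//.
  rewrite (_ : q3 ((Q + t *: P) x) = q3 (Q x) + t * q3 (P x))//.
  rewrite bulk_taylor /wdot; ring.
rewrite (funext E).
have -> : (fun t => E0 + t * first_variation Q P + t ^+ 2 * E2 + t ^+ 3 * E3 + t ^+ 4 * E4)
    = horner (Poly [:: E0; first_variation Q P; E2; E3; E4]).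
  by apply/funext => t; rewrite horner_Poly /=; ring.
have := is_derive_poly (Poly [:: E0; first_variation Q P; E2; E3; E4]) 0.
by rewrite horner_coef0 coef_deriv coef_Poly /= mulr1n.
Qed.

End FirstVariation.

(** * Uniqueness of critical points *)

Section Uniqueness.
Context {R : realType}.
Variables theta lambda : R.
Notation mu := (@lebesgue_measure R).
Notation I11 := (`[-1, 1]%classic : set R).
Implicit Types Q P : R -> R * R * R.

(** In terms of the midpoint m and the half difference e of the two points, the
    odd symmetry of the gradient difference in e leaves few terms: the quartic
    part contributes 8 |m|^2 |e|^2 and further squares, the cubic part is
    linear in m and quadratic in e. The constant 30 makes the rest of the
    sum, after completing squares in m, a sum of squares. *)
Lemma bulk_semiconvex (a b c a' b' c' : R) :
  - (30 + `|theta|) * wnorm (a - a') (b - b') (c - c') <=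
  bulk_poly1 theta a b c (a - a') (b - b') (c - c') -
  bulk_poly1 theta a' b' c' (a - a') (b - b') (c - c').
Proof.
pose m1 := (a + a') / 2; pose e1 := (a - a') / 2.
pose m2 := (b + b') / 2; pose e2 := (b - b') / 2.
pose m3 := (c + c') / 2; pose e3 := (c - c') / 2.
have -> : a = m1 + e1 by rewrite /m1 /e1; field.
have -> : a' = m1 - e1 by rewrite /m1 /e1; field.
have -> : b = m2 + e2 by rewrite /m2 /e2; field.
have -> : b' = m2 - e2 by rewrite /m2 /e2; field.
have -> : c = m3 + e3 by rewrite /m3 /e3; field.
have -> : c' = m3 - e3 by rewrite /m3 /e3; field.
rewrite -subr_ge0 /bulk_poly1 /dbulk1 /dbulk2 /dbulk3 /wnorm.
have th0 : 0 <= `|theta| + 2 / 3 * theta.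
  by have := ler_norm (- theta); rewrite normrN; have := normr_ge0 theta; lra.
move: th0; move: m1 m2 m3 e1 e2 e3 `|theta| => m1 m2 m3 e1 e2 e3 t th0.
(* The shifts m1 +- 2, m2 e2 - 4 e1 and m3 e3 - 4 e1 absorb the cubic part. *)
rewrite [X in 0 <= X](_ : _ =
  4 * ((t + 2 / 3 * theta) * (3 * e1 ^+ 2 + e2 ^+ 2 + e3 ^+ 2))
  + 2 * (3 * e1 ^+ 2 + e2 ^+ 2 + e3 ^+ 2)
  + 16 * (3 * m1 * e1 + m2 * e2 + m3 * e3) ^+ 2
  + 8 * (3 * e1 ^+ 2 + e2 ^+ 2 + e3 ^+ 2) ^+ 2
  + 24 * (e1 * (m1 + 2)) ^+ 2 + 8 * ((e2 * (m1 - 2)) ^+ 2 + (e3 * (m1 - 2)) ^+ 2)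
  + 8 * (m2 * e2 - 4 * e1) ^+ 2 + 8 * (m3 * e3 - 4 * e1) ^+ 2
  + 16 * (3 * (m1 * e1) ^+ 2 + (m1 * e2) ^+ 2 + (m1 * e3) ^+ 2)
  + 8 * (3 * (m2 * e1) ^+ 2 + (m2 * e3) ^+ 2)
  + 8 * (3 * (m3 * e1) ^+ 2 + (m3 * e2) ^+ 2)
  + 2 * e1 ^+ 2 + 86 * (e2 ^+ 2 + e3 ^+ 2)); last by field.
by repeat first [exact: sqr_ge0 | exact: th0 | done | apply: addr_ge0 | apply: mulr_ge0].
Qed.

Lemma first_variationE Q P (g1 g2 g3 h1 h2 h3 : R -> R) : H1_3 Q -> H1_3 P ->
  is_weak_derivative (@q1 R \o Q) g1 -> is_weak_derivative (@q2 R \o Q) g2 ->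
  is_weak_derivative (@q3 R \o Q) g3 ->
  is_weak_derivative (@q1 R \o P) h1 -> is_weak_derivative (@q2 R \o P) h2 ->
  is_weak_derivative (@q3 R \o P) h3 ->
  first_variation theta lambda Q P = int11 (fun x =>
    2 / lambda ^+ 2 * wdot (g1 x) (g2 x) (g3 x) (h1 x) (h2 x) (h3 x)
    + bulk_poly1 theta (q1 (Q x)) (q2 (Q x)) (q3 (Q x)) (q1 (P x)) (q2 (P x)) (q3 (P x))).
Proof.
move=> [HQ1 HQ2 HQ3] [HP1 HP2 HP3] G1 G2 G3 H1' H2 H3.
have DQ1 := weak_derivative_spec HQ1; have DP1 := weak_derivative_spec HP1.
have DQ2 := weak_derivative_spec HQ2; have DP2 := weak_derivative_spec HP2.
have DQ3 := weak_derivative_spec HQ3; have DP3 := weak_derivative_spec HP3.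
have [cQ1 _ _] := HQ1; have [cQ2 _ _] := HQ2; have [cQ3 _ _] := HQ3.
have [cP1 _ _] := HP1; have [cP2 _ _] := HP2; have [cP3 _ _] := HP3.
have [_ cb1 _ _ _] := cont11_bulk_poly theta cQ1 cQ2 cQ3 cP1 cP2 cP3.
have Lb := cont11_L1 cb1.
apply: int11_ae.
- apply: L1_measurable; apply: L1D Lb; apply: L1Z.
  exact: (L1_wdot DQ1.1 DQ2.1 DQ3.1 DP1.1 DP2.1 DP3.1).
- apply: L1_measurable; apply: L1D Lb; apply: L1Z.
  exact: (L1_wdot G1.1 G2.1 G3.1 H1'.1 H2.1 H3.1).
have aeF := ae_filter_ringOfSetsType mu.
have EQ : {ae mu, forall x, I11 x -> [/\ weak_derivative (@q1 R \o Q) x = g1 x,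
    weak_derivative (@q2 R \o Q) x = g2 x & weak_derivative (@q3 R \o Q) x = g3 x]}.
  apply: filterS3 (weak_derivative_unique cQ1 DQ1 G1) (weak_derivative_unique cQ2 DQ2 G2)
    (weak_derivative_unique cQ3 DQ3 G3) => x e1 e2 e3 xI.
  by split; [exact: e1|exact: e2|exact: e3].
have EP : {ae mu, forall x, I11 x -> [/\ weak_derivative (@q1 R \o P) x = h1 x,
    weak_derivative (@q2 R \o P) x = h2 x & weak_derivative (@q3 R \o P) x = h3 x]}.
  apply: filterS3 (weak_derivative_unique cP1 DP1 H1') (weak_derivative_unique cP2 DP2 H2)
    (weak_derivative_unique cP3 DP3 H3) => x e1 e2 e3 xI.
  by split; [exact: e1|exact: e2|exact: e3].
apply: filterS2 EQ EP => x eQ eP xI.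
by have [-> -> ->] := eQ xI; have [-> -> ->] := eP xI.
Qed.

Lemma critical_pointP Q : critical_point theta lambda Q <->
  Hspace theta Q /\ forall P, H10_3 P -> first_variation theta lambda Q P = 0.
Proof.
split=> -[HQ crit]; split=> // P HP.
  have [H1P _ _] := HP; have [H1Q _ _] := HQ.
  have d1 := crit _ HP; have d2 := energy_first_variation theta lambda H1Q H1P.
  by rewrite -(@derive_val _ _ _ _ _ _ _ d2) (@derive_val _ _ _ _ _ _ _ d1).
have [H1P _ _] := HP; have [H1Q _ _] := HQ.
by have := energy_first_variation theta lambda H1Q H1P; rewrite crit.
Qed.

Lemma wdotxx (a b c : R) : wdot a b c a b c = wnorm a b c.
Proof. by rewrite /wdot /wnorm !expr2. Qed.

Lemma wnorm_ge0 (a b c : R) : 0 <= wnorm a b c.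
Proof.
rewrite /wnorm; have := sqr_ge0 a; have := sqr_ge0 b; have := sqr_ge0 c; lra.
Qed.

Lemma wnorm_le (a b c A B C : R) : a ^+ 2 <= 2 * A -> b ^+ 2 <= 2 * B ->
  c ^+ 2 <= 2 * C -> wnorm a b c <= 2 * (3 * A + B + C).
Proof. rewrite /wnorm; lra. Qed.

Lemma wnorm_le0 (a b c : R) : wnorm a b c <= 0 -> [/\ a = 0, b = 0 & c = 0].
Proof.
rewrite /wnorm; have := sqr_ge0 a; have := sqr_ge0 b; have := sqr_ge0 c => c0 b0 a0 h.
by split; apply/eqP; rewrite -sqrf_eq0; apply/eqP; lra.
Qed.

(** With D = Q - Q' and W the integral of [wnorm] of D', the difference of the two
    Euler-Lagrange equations tested with D gives
    2 / lambda^2 * W <= (30 + |theta|) * (integral of [wnorm] of D), and the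
    Poincare inequality bounds the last integral by 4 W; smallness of lambda forces
    W = 0. *)
Lemma critical_point_unique Q Q' : 0 < lambda ->
  2 * (30 + `|theta|) * lambda ^+ 2 < 1 ->
  critical_point theta lambda Q -> critical_point theta lambda Q' ->
  forall x, x \in `[-1, 1] -> Q x = Q' x.
Proof.
move=> l0 lsmall /critical_pointP[HQ crit] /critical_pointP[HQ' crit'].
have [[HQ1 HQ2 HQ3] Qm Qp] := HQ; have [[HQ1' HQ2' HQ3'] Qm' Qp'] := HQ'.
pose D : R -> R * R * R := fun x => Q x - Q' x.
have G1 := weak_derivative_spec HQ1; have G1' := weak_derivative_spec HQ1'.
have G2 := weak_derivative_spec HQ2; have G2' := weak_derivative_spec HQ2'.
have G3 := weak_derivative_spec HQ3; have G3' := weak_derivative_spec HQ3'.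
have [c1 _ _] := HQ1; have [c2 _ _] := HQ2; have [c3 _ _] := HQ3.
have [c1' _ _] := HQ1'; have [c2' _ _] := HQ2'; have [c3' _ _] := HQ3'.
have D1E : @q1 R \o D = (fun x => q1 (Q x) + (-1) * q1 (Q' x)).
  by apply/funext => x; rewrite mulN1r.
have D2E : @q2 R \o D = (fun x => q2 (Q x) + (-1) * q2 (Q' x)).
  by apply/funext => x; rewrite mulN1r.
have D3E : @q3 R \o D = (fun x => q3 (Q x) + (-1) * q3 (Q' x)).
  by apply/funext => x; rewrite mulN1r.
have H1D : H1_3 D.
  by split; rewrite ?D1E ?D2E ?D3E; exact: H1DZ.
have H10D : H10_3 D by split=> //; rewrite /D ?Qm ?Qm' ?Qp ?Qp' subrr.
have W1 := is_weak_derivativeDZ (-1) c1 c1' G1 G1'.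
have W2 := is_weak_derivativeDZ (-1) c2 c2' G2 G2'.
have W3 := is_weak_derivativeDZ (-1) c3 c3' G3 G3'.
rewrite -D1E in W1; rewrite -D2E in W2; rewrite -D3E in W3.
have [H1Q _ _] := HQ; have [H1Q' _ _] := HQ'.
have V := crit _ H10D; have V' := crit' _ H10D.
rewrite (first_variationE H1Q H1D G1 G2 G3 W1 W2 W3) in V.
rewrite (first_variationE H1Q' H1D G1' G2' G3' W1 W2 W3) in V'.
move: V V' W1 W2 W3.
set g1 := weak_derivative (@q1 R \o Q); set g1' := weak_derivative (@q1 R \o Q').
set g2 := weak_derivative (@q2 R \o Q); set g2' := weak_derivative (@q2 R \o Q').
set g3 := weak_derivative (@q3 R \o Q); set g3' := weak_derivative (@q3 R \o Q').
set h1 := fun x => g1 x + -1 * g1' x; set h2 := fun x => g2 x + -1 * g2' x.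
set h3 := fun x => g3 x + -1 * g3' x.
move=> V V' W1 W2 W3.
have [HD1 HD2 HD3] := H1D.
have [cD1 _ _] := HD1; have [cD2 _ _] := HD2; have [cD3 _ _] := HD3.
have [_ cb _ _ _] := cont11_bulk_poly theta c1 c2 c3 cD1 cD2 cD3.
have [_ cb' _ _ _] := cont11_bulk_poly theta c1' c2' c3' cD1 cD2 cD3.
have Lh := L1_wdot W1.1 W2.1 W3.1 W1.1 W2.1 W3.1.
have LV := L1D (L1Z (2 / lambda ^+ 2) (L1_wdot G1.1 G2.1 G3.1 W1.1 W2.1 W3.1))
  (cont11_L1 cb).
have LV' := L1D (L1Z (2 / lambda ^+ 2) (L1_wdot G1'.1 G2'.1 G3'.1 W1.1 W2.1 W3.1))
  (cont11_L1 cb').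
pose K x := wdot (h1 x) (h2 x) (h3 x) (h1 x) (h2 x) (h3 x).
pose N x := wnorm (q1 (D x)) (q2 (D x)) (q3 (D x)).
have LK : L1 K by [].
have LN : L1 N.
  have [_ _ _ _ c4] := cont11_bulk_poly theta c1 c2 c3 cD1 cD2 cD3.
  by apply: cont11_L1; rewrite /N /wnorm;
    apply: cont11D; [apply: cont11D; [apply: cont11M; [exact: cont11_cst|]|]|];
    apply: cont11X.
have ineq : 2 / lambda ^+ 2 * int11 K - (30 + `|theta|) * int11 N <= 0.
  rewrite -[leRHS](subrr 0) -{1}V -V' -(int11B LV LV').
  rewrite -(int11Z _ LK) -(int11Z _ LN) -int11B; [|exact: L1Z|exact: L1Z].
  apply: int11_le; [by apply: L1B; exact: L1Z|exact: L1B|].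
  move=> x _; rewrite /K /N.
  have := bulk_semiconvex ((@q1 R \o Q) x) ((@q2 R \o Q) x) ((@q3 R \o Q) x)
    ((@q1 R \o Q') x) ((@q2 R \o Q') x) ((@q3 R \o Q') x).
  rewrite -[_ - _]/((@q1 R \o D) x) -[X in wnorm _ X]/((@q2 R \o D) x).
  rewrite -[X in wnorm _ _ X]/((@q3 R \o D) x) mulNr.
  move: (bulk_poly1 _ _ _ _ _ _ _) (bulk_poly1 _ _ _ _ _ _ _) (wnorm _ _ _) => B B' w.
  rewrite /wdot /h1 /h2 /h3; move: (2 / lambda ^+ 2) (30 + _) => k C H.
  rewrite -/g1 -/g2 -/g3 -/g1' -/g2' -/g3'.
  rewrite -subr_ge0 [leRHS](_ : _ = B' - B - - (C * w)); last by ring.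
  by rewrite subr_ge0.
pose W := int11 K.
have W0 : 0 <= W.
  by apply: int11_ge0 => x _; rewrite /K wdotxx wnorm_ge0.
(* Pointwise Poincare inequality; integrating it over an interval of length 2
   gives the factor 4 below. *)
have Nle x : -1 <= x <= 1 -> N x <= 2 * W.
  move=> x1.
  have Dm : D (-1) = 0 by case: H10D.
  have z1 : (@q1 R \o D) (-1) = 0 by rewrite /comp Dm.
  have z2 : (@q2 R \o D) (-1) = 0 by rewrite /comp Dm.
  have z3 : (@q3 R \o D) (-1) = 0 by rewrite /comp Dm.
  have P1 := poincare cD1 W1 z1 x1; have P2 := poincare cD2 W2 z2 x1.
  have P3 := poincare cD3 W3 z3 x1.
  have L11 : L1 (fun x => h1 x ^+ 2) by case: W1 => -[].
  have L22 : L1 (fun x => h2 x ^+ 2) by case: W2 => -[].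
  have L33 : L1 (fun x => h3 x ^+ 2) by case: W3 => -[].
  have WE : W = 3 * int11 (fun x => h1 x ^+ 2) + int11 (fun x => h2 x ^+ 2)
      + int11 (fun x => h3 x ^+ 2).
    have L31 := L1Z 3 L11; have L312 := L1D L31 L22.
    rewrite -(int11Z 3 L11) -(int11D L31 L22) -(int11D L312 L33) /W.
    by apply: int11_ext => y _; rewrite /K /wdot !expr2.
  rewrite WE; exact (wnorm_le P1 P2 P3).
have NleW : int11 N <= 4 * W.
  have -> : 4 * W = int11 (fun=> 2 * W) by rewrite int11_cst; ring.
  apply: int11_le; [exact: LN|exact: cont11_L1 (@cont11_cst _ _)|move=> x].
  by rewrite /= in_itv/=; exact: Nle.
have W00 : W = 0.
  apply/eqP; rewrite eq_le W0 andbT leNgt; apply/negP => Wp.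
  have C0 : 0 < 30 + `|theta| by rewrite ltr_pwDl.
  have l20 : 0 < lambda ^+ 2 by rewrite exprn_gt0.
  have : 2 * W <= 4 * ((30 + `|theta|) * lambda ^+ 2) * W.
    have : 2 / lambda ^+ 2 * W <= (30 + `|theta|) * (4 * W).
      by apply: le_trans (ler_wpM2l (ltW C0) NleW); rewrite -subr_le0.
    rewrite -(ler_pM2r l20) => H.
    rewrite [leLHS](_ : _ = 2 / lambda ^+ 2 * W * lambda ^+ 2); last first.
      by field; rewrite gt_eqF.
    by apply: le_trans H _; rewrite le_eqVlt; apply/orP; left; apply/eqP; ring.
  rewrite leNgt => /negP; apply; rewrite ltr_pM2r//.
  by move: lsmall; move: (_ + _) (lambda ^+ 2) => C l; clear; lra.
move=> x; rewrite in_itv/= => x1.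
have := Nle x x1; rewrite W00 mulr0 => /wnorm_le0[].
have : D x = Q x - Q' x by [].
rewrite /q1 /q2 /q3; case: (D x) => -[a b] c /= DE a0 b0 c0.
by apply/eqP; rewrite -subr_eq0; apply/eqP; rewrite -DE a0 b0 c0.
Qed.

End Uniqueness.

(** * Contractions in the sup norm *)

(** The Banach fixed point theorem for functions on any set, stated for a class
    of functions rather than a complete space of functions. Since the class is
    uniformly bounded, the iterates s (n + k) = T^n (s k) and s n = T^n u0 are
    within 2 K / 2^n of each other, which avoids summing a geometric series. *)
Section Contraction.
Context {R : realType} {X : Type}.
Variables (C : set (X -> R)) (T : (X -> R) -> X -> R) (u0 : X -> R) (K : R).
Hypothesis Cu0 : C u0.
Hypothesis CT : forall u, C u -> C (T u).
Hypothesis CK : forall u, C u -> forall x, `|u x| <= K.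
Hypothesis ctr : forall u v e, C u -> C v -> (forall x, `|u x - v x| <= e) ->
  forall x, `|T u x - T v x| <= e / 2.
Hypothesis closedC : forall (s : nat -> X -> R) u, (forall n, C (s n)) ->
  (forall e, 0 < e -> exists n, forall x, `|u x - s n x| <= e) -> C u.

Let s n := iter n T u0.

Let Cs n : C (s n).
Proof. by elim: n => [|n IHn] /=; [exact: Cu0|exact: CT]. Qed.

Let ds n k x : `|s (n + k)%N x - s n x| <= 2 * K * 2^-1 ^+ n.
Proof.
elim: n k x => [|n IHn] k x.
  rewrite add0n expr0 mulr1 (le_trans (ler_normB _ _))//.
  by have := CK (Cs k) x; have := CK Cu0 x; lra.
rewrite addSn exprSr mulrA; apply: (ctr (Cs _) (Cs _)); exact: IHn.
Qed.

Let small e : 0 < e -> exists n, 2 * K * 2^-1 ^+ n <= e.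
Proof.
move=> e0.
have : (2 * K * 2^-1 ^+ n) @[n --> \oo] --> (2 * K * 0 : R).
  apply: cvgM; first exact: cvg_cst.
  by apply: cvg_expr; rewrite ger0_norm ?invr_ge0// invf_lt1// ltr1n.
rewrite mulr0 => /cvgrPdist_le/(_ e e0)[n _ /(_ n (leqnn n))] /=.
rewrite sub0r normrN => h; exists n; exact: le_trans (ler_norm _) h.
Qed.

Let cvs x : cvg (s n x @[n --> \oo]).
Proof.
apply/cauchy_cvgP/cauchy_exP => e e0.
have e20 : 0 < e / 2 by rewrite divr_gt0.
have [n hn] := small e20.
exists (s n x); exists n => // m /= nm.
rewrite /ball /= -(subnKC nm) distrC.
by apply: le_lt_trans (ds n _ x) _; lra.
Qed.

Lemma sup_contraction_fixpoint : exists2 u, C u & forall x, T u x = u x.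
Proof.
pose u x := lim (s n x @[n --> \oo]).
have us n x : `|u x - s n x| <= 2 * K * 2^-1 ^+ n.
  have cv : `|s (m + n)%N x - s n x| @[m --> \oo] --> `|u x - s n x|.
    apply: cvg_norm; apply: cvgB; last exact: cvg_cst.
    by rewrite (cvg_shiftn n (fun m => s m x)); exact: cvs.
  by apply: (cvgr_to_le cv); apply: nearW => m; rewrite addnC; exact: ds.
have Cu : C u.
  apply: (closedC Cs) => e /small[n hn].
  by exists n => x; apply: le_trans (us n x) hn.
exists u => // x; apply/eqP; rewrite -subr_eq0 -normr_le0.
apply/ler_addgt0Pr => e e0; rewrite add0r.
have e40 : 0 < e / 4 by rewrite divr_gt0.
have [n hn] := small e40.
have := ctr Cu (Cs n) (us n) x; have := ds n 1 x; have := us n x.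
rewrite addn1 -[s n.+1]/(T (s n)) !ler_norml; move: (u x) (T u x) (T (s n) x) (s n x) => a b c d.
move=> /andP[? ?] /andP[? ?] /andP[? ?]; apply/andP; split; lra.
Qed.

End Contraction.

(** * The Green operator of the second derivative *)

Section BoundaryValueProblem.
Context {R : realType}.
Implicit Types f g h u v w : R -> R.
Notation mu := (@lebesgue_measure R).

(** Compact support makes integrals from minus infinity finite, so primitives are
    differentiable on the whole line and no one-sided derivatives occur at -1
    and 1. *)
Definition cutoff (x : R) := clamp 0 1 (2 - `|x|).

Lemma cutoff_continuous : continuous cutoff.
Proof.
apply: (@lipschitz_continuous _ 1) => x y.
apply: le_trans (clamp_lipschitz _ _ ler01) _; rewrite !mul1r.
rewrite (_ : _ - _ = `|y| - `|x|); last by ring.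
by rewrite (distrC x); exact: ler_dist_dist.
Qed.

Lemma cutoff1 (x : R) : -1 <= x <= 1 -> cutoff x = 1.
Proof.
move=> x1; apply: clamp_ge => //.
have : `|x| <= 1 by rewrite ler_norml.
lra.
Qed.

Lemma cutoff0 (x : R) : 2 <= `|x| -> cutoff x = 0.
Proof. by move=> x2; apply: clamp_le => //; lra. Qed.

Definition primitive h (x : R) := \int[mu]_(t in `]-oo, x]) (cutoff t * h t).

Lemma primitive_C1 h : continuous h ->
  C1 (primitive h) (fun x => cutoff x * h x).
Proof.
move=> ch.
have cc : continuous (fun x => cutoff x * h x).
  by move=> x; apply: cvgM; [exact: cutoff_continuous|exact: ch].
split=> // x.
have mT : measurable (`]-oo, (x + 1)]%classic : set (measurableTypeR R)) by exact: measurable_itv.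
have m2 : measurable (`[-2, 2]%classic : set (measurableTypeR R)) by exact: measurable_itv.
have L2 : mu.-integrable `[-2, 2] (EFin \o (fun x => cutoff x * h x)).
  apply: continuous_compact_integrable; first exact: segment_compact.
  exact: continuous_subspaceT.
have ic : mu.-integrable `]-oo, (x + 1)] (EFin \o (fun x => cutoff x * h x)).
  have -> : (fun x => cutoff x * h x) = (fun x => cutoff x * h x) \_ `[-2, 2].
    apply/funext => y; rewrite patchE; case: ifPn => //.
    rewrite notin_setE /= in_itv/= => /negP out; rewrite cutoff0 ?mul0r//.
    by rewrite leNgt; apply: contra out; rewrite ltr_norml => /andP[? ?]; rewrite !ltW.
  rewrite -restrict_EFin; apply/(integrable_restrict mu m2 mT).
  apply: (integrableS m2 _ _ L2); last by move=> ? [].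
  exact: measurableI.
have x1 : x < x + 1 by rewrite ltrDl.
have [d e] := continuous_FTC1 x1 ic (ltNyr _) (cc x).
apply: DeriveDef; [exact: d|by rewrite -derive1E; exact: e].
Qed.

Lemma C1_MVT f f' (B a b : R) : C1 f f' -> -1 <= a <= 1 -> -1 <= b <= 1 ->
  (forall x, -1 <= x <= 1 -> `|f' x| <= B) -> `|f a - f b| <= B * `|a - b|.
Proof.
move=> Cf.
wlog ab : a b / a <= b.
  move=> H a1 b1 fB; have [ab|/ltW ba] := leP a b; first exact: H.
  by rewrite distrC (distrC a); exact: H.
move=> /andP[a1 a1'] /andP[b1 b1'] fB.
have cf : {within `[a, b], continuous f}.
  by apply: continuous_subspaceT; exact: C1_continuous Cf.
have [c cab e] := MVT_segment ab (fun x _ => Cf.1 x) cf.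
rewrite distrC e normrM (distrC a) ler_wpM2r// fB//.
by move: cab; rewrite in_itv/= => /andP[? ?]; apply/andP; split; lra.
Qed.

(** The derivative v' = w vanishes somewhere by Rolle, so its size is at most 2 B,
    and v vanishes at -1. *)
Lemma bvp_bound v v' w w' (B : R) : C1 v v' -> C1 w w' ->
  v (-1) = 0 -> v 1 = 0 ->
  (forall x, -1 <= x <= 1 -> v' x = w x) ->
  (forall x, -1 <= x <= 1 -> `|w' x| <= B) ->
  forall x, -1 <= x <= 1 -> `|v x| <= 4 * B.
Proof.
move=> Cv Cw vm v1 vw wB x x1.
have n11 : -1 < 1 :> R by lra.
have cv : {within `[-1, 1], continuous v}.
  by apply: continuous_subspaceT; exact: C1_continuous Cv.
have [c + e] := MVT n11 (fun x _ => Cv.1 x) cv.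
rewrite in_itv/= => /andP[c1 c1'].
have c11 : -1 <= c <= 1 by rewrite !ltW.
have wc : w c = 0.
  by rewrite -vw//; move: e; rewrite vm v1; lra.
have B0 : 0 <= B by apply: le_trans (wB c c11).
have wB2 y : -1 <= y <= 1 -> `|v' y| <= 2 * B.
  move=> y1; rewrite vw//; have := C1_MVT Cw y1 c11 wB.
  rewrite wc subr0 => H; apply: le_trans H _.
  rewrite mulrC ler_wpM2r// ler_norml; lra.
have m1 : -1 <= (-1 : R) <= 1 by lra.
have := C1_MVT Cv x1 m1 wB2; rewrite vm subr0 => H; apply: le_trans H _.
rewrite (_ : 4 * B = 2 * B * 2); last by ring.
by rewrite ler_wpM2l ?mulr_ge0// ler_norml; lra.
Qed.

(** [green h] is the solution of v'' = h with zero boundary values: the double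
    primitive minus its affine interpolation at -1 and 1. On that interval its
    derivative is [dgreen h], which unlike the derivative on the whole line is
    again continuously differentiable, being free of the merely Lipschitz
    cutoff. *)
Definition slope h := (primitive (primitive h) 1 - primitive (primitive h) (-1)) / 2.
Definition green h (x : R) :=
  primitive (primitive h) x - primitive (primitive h) (-1) - slope h * (x + 1).
Definition dgreen h (x : R) := primitive h x - slope h.

Lemma green_C1 h : continuous h -> exists2 v', C1 (green h) v' &
  forall x, -1 <= x <= 1 -> v' x = dgreen h x.
Proof.
move=> ch; have cp := C1_continuous (primitive_C1 ch).
have := C1B (C1B (primitive_C1 cp) (C1_cst (primitive (primitive h) (-1))))
  (C1_affine (slope h) 1).
move=> Cg; eexists; first exact: Cg.
by move=> x x1; rewrite /= cutoff1// mul1r subr0.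
Qed.

Lemma dgreen_C1 h : continuous h -> exists2 w', C1 (dgreen h) w' &
  forall x, -1 <= x <= 1 -> w' x = h x.
Proof.
move=> ch; have Cg := C1B (primitive_C1 ch) (C1_cst (slope h)).
eexists; first exact: Cg.
by move=> x x1; rewrite /= cutoff1// mul1r subr0.
Qed.

Lemma green_m1 h : green h (-1) = 0.
Proof. by rewrite /green addNr mulr0 !subrr. Qed.

Lemma green_1 h : green h 1 = 0.
Proof. by rewrite /green /slope; field. Qed.

Lemma green_lipschitz h k (e : R) : continuous h -> continuous k ->
  (forall x, `|h x - k x| <= e) ->
  forall x, -1 <= x <= 1 -> `|green h x - green k x| <= 4 * e.
Proof.
move=> ch ck hk.
have [gh Ch hE] := green_C1 ch; have [gk Ck kE] := green_C1 ck.
have [gh1 Ch1 hE1] := dgreen_C1 ch; have [gk1 Ck1 kE1] := dgreen_C1 ck.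
apply: (bvp_bound (C1B Ch Ck) (C1B Ch1 Ck1)).
- by rewrite !green_m1 subrr.
- by rewrite !green_1 subrr.
- by move=> x x1; rewrite hE// kE.
- by move=> x x1; rewrite hE1// kE1.
Qed.

Lemma green_bound h (e : R) : continuous h -> (forall x, `|h x| <= e) ->
  forall x, -1 <= x <= 1 -> `|green h x| <= 4 * e.
Proof.
move=> ch he.
have [gh Ch hE] := green_C1 ch; have [gh1 Ch1 hE1] := dgreen_C1 ch.
apply: (bvp_bound Ch Ch1) => [|||x x1]; [exact: green_m1|exact: green_1|exact: hE|].
by rewrite hE1.
Qed.

End BoundaryValueProblem.

(** * Existence of a critical point *)

Section Existence.
Context {R : realType}.
Variable theta : R.

(** The right-hand sides of the Euler-Lagrange equations on the slice q3 = 0,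
    divided by lambda^2; the index true stands for q1 and false for q2. The
    divisors 6 and 2 are twice the weights of q1'^2 and q2'^2 in the energy. *)
Definition forcing (i : bool) (a b : R) : R :=
  if i then dbulk1 theta a b 0 / 6 else dbulk2 theta a b 0 / 2.

Definition lip (M : R) := `|theta| + 8 * M + 12 * M ^+ 2.

Lemma forcing_lipschitz (M : R) i (a b a' b' e : R) : 0 <= M ->
  `|a| <= M -> `|b| <= M -> `|a'| <= M -> `|b'| <= M ->
  `|a - a'| <= e -> `|b - b'| <= e ->
  `|forcing i a b - forcing i a' b'| <= lip M * e.
Proof.
move=> M0 aM bM aM' bM' ae be.
have e0 : 0 <= e by apply: le_trans ae.
have nM (x y X Y : R) : `|x| <= X -> `|y| <= Y -> `|x * y| <= X * Y.
  by move=> xX yY; rewrite normrM ler_pM.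
have nD (x y X Y : R) : `|x| <= X -> `|y| <= Y -> `|x + y| <= X + Y.
  by move=> xX yY; rewrite (le_trans (ler_normD _ _))// lerD.
have nc (k : R) : 0 <= k -> `|k| <= k by move=> k0; rewrite ger0_norm.
have nN (x X : R) : `|x| <= X -> `|- x| <= X by rewrite normrN.
have tt := lexx `|theta|.
have th0 := normr_ge0 theta.
have M2 : 0 <= M ^+ 2 by exact: sqr_ge0.
case: i; rewrite /forcing /dbulk1 /dbulk2 /wnorm.
  rewrite (_ : _ - _ =
    (theta * (1 / 3) + 2 * (a + a') + 3 * (a * a + a * a' + a' * a') + b * b) * (a - a')
    + (- (2 / 3 * (b + b')) + a' * (b + b')) * (b - b')); last by field.
  apply: (@le_trans _ _ ((`|theta| * (1 / 3) + 2 * (M + M)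
      + 3 * (M * M + M * M + M * M) + M * M) * e
      + (2 / 3 * (M + M) + M * (M + M)) * e)).
    by repeat first [assumption | (apply: (nc); done) | apply: (nN) | apply: (nM) | apply: (nD)].
  by rewrite -mulrDl ler_wpM2r// /lip expr2; lra.
rewrite (_ : _ - _ =
    (- (4 * b) + 3 * ((a + a') * b)) * (a - a')
    + (theta * (1 / 3) + - (4 * a') + 3 * (a' * a') + (b * b + b * b' + b' * b'))
     * (b - b')); last by field.
apply: (@le_trans _ _ ((4 * M + 3 * ((M + M) * M)) * e
      + (`|theta| * (1 / 3) + 4 * M + 3 * (M * M) + (M * M + M * M + M * M)) * e)).
  by repeat first [assumption | (apply: (nc); done) | apply: (nN) | apply: (nM) | apply: (nD)].
by rewrite -mulrDl ler_wpM2r// /lip expr2; lra.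
Qed.

Lemma forcing_continuous i (f g : R -> R) : continuous f -> continuous g ->
  continuous (fun x => forcing i (f x) (g x)).
Proof.
move=> cf cg.
have cD (h k : R -> R) : continuous h -> continuous k -> continuous (fun x => h x + k x).
  by move=> ch ck x; apply: cvgD; [exact: ch|exact: ck].
have cM (h k : R -> R) : continuous h -> continuous k -> continuous (fun x => h x * k x).
  by move=> ch ck x; apply: cvgM; [exact: ch|exact: ck].
have cN (h : R -> R) : continuous h -> continuous (fun x => - h x).
  by move=> ch x; apply: cvgN; exact: ch.
have cC (k : R) : continuous (fun _ : R => k) by move=> x; exact: cvg_cst.
have cX (h : R -> R) n : continuous h -> continuous (fun x => h x ^+ n).
  move=> ch; elim: n => [|n IHn]; first exact: cC.
  by under eq_fun do rewrite exprS; exact: cM.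
case: i; rewrite /forcing /dbulk1 /dbulk2 /wnorm; repeat lazymatch goal with
  | |- continuous (fun x => @?h x + @?k x) => refine (@cD h k _ _); cbv beta
  | |- continuous (fun x => @?h x * @?k x) => refine (@cM h k _ _); cbv beta
  | |- continuous (fun x => @?h x ^+ ?n) => refine (@cX h n _); cbv beta
  | |- continuous (fun x => - @?h x) => refine (@cN h _); cbv beta
  | |- continuous (fun x => ?h x) => change (continuous h); assumption
  | |- continuous (fun x => ?k) => exact (@cC k)
  end.
Qed.

(** The affine interpolation of the boundary data. *)
Definition ell (i : bool) (x : R) : R :=
  if i then qplus theta else - 3 * qplus theta * x.
Definition ell' (i : bool) : R := if i then 0 else - 3 * qplus theta.

Lemma ell_C1 i : C1 (ell i) (fun=> ell' i).
Proof.
case: i; first exact: C1_cst.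
rewrite (_ : ell false = (fun x => - 3 * qplus theta * (x + 0))); first exact: C1_affine.
by apply/funext => x; rewrite addr0.
Qed.

(** The boundary data are at most 3 * qplus; the extra 1 is room for the term of
    order lambda^2. *)
Definition bound := 3 * qplus theta + 1.

Lemma qplus_gt0 : 0 < qplus theta.
Proof. by rewrite divr_gt0// ltr_pwDl// sqrtr_ge0. Qed.

Lemma ell_bound i x : -1 <= x <= 1 -> `|ell i x| <= 3 * qplus theta.
Proof.
have q0 := qplus_gt0; case: i => /= x1; first by rewrite ger0_norm; lra.
have : `|x| <= 1 by rewrite ler_norml.
rewrite !ler_norml => /andP[xl xr].
have h1 : 0 <= qplus theta * (1 - x) by rewrite mulr_ge0 ?(ltW q0)//; lra.
have h2 : 0 <= qplus theta * (1 + x) by rewrite mulr_ge0 ?(ltW q0)//; lra.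
by apply/andP; split; lra.
Qed.

Let clamp11 := clamp (- 1) (1 : R).

Let n11 : -1 <= 1 :> R. Proof. lra. Qed.

Variable lambda : R.

Definition source (u : bool * R -> R) (i : bool) (x : R) :=
  forcing i (u (true, x)) (u (false, x)).

Definition profile (u : bool * R -> R) (i : bool) (x : R) : R :=
  ell i x + lambda ^+ 2 * green (source u i) x.

Definition admissible : set (bool * R -> R) :=
  [set u | (forall i, continuous (fun x => u (i, x))) /\ forall p, `|u p| <= bound].

Lemma source_continuous u i : admissible u -> continuous (source u i).
Proof. by move=> [cu _]; apply: forcing_continuous; exact: cu. Qed.

Lemma source_lipschitz u v e i x : admissible u -> admissible v ->
  (forall p, `|u p - v p| <= e) ->
  `|source u i x - source v i x| <= lip bound * e.
Proof.
move=> [_ uM] [_ vM] uv; apply: forcing_lipschitz => //.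
by rewrite /bound; have := qplus_gt0; lra.
Qed.

Lemma source_bound u i x : admissible u -> `|source u i x| <= lip bound * bound.
Proof.
have b0 : 0 <= bound by rewrite /bound; have := qplus_gt0; lra.
move=> [_ uM]; have := @forcing_lipschitz bound i (u (true, x)) (u (false, x)) 0 0 bound b0.
rewrite normr0 !subr0 (_ : forcing i 0 0 = 0) ?subr0; first by apply.
by case: (i); rewrite /forcing /dbulk1 /dbulk2 /wnorm; field.
Qed.

(** The operator is evaluated at the projection of x to the interval, which
    makes its values bounded and continuous on the whole line; the fixed point
    equation only matters on the interval, where the projection is the
    identity. *)
Lemma profile_fixpoint : 8 * lip bound * lambda ^+ 2 <= 1 ->
  4 * lip bound * bound * lambda ^+ 2 <= 1 ->
  exists2 u, admissible u & forall i x, -1 <= x <= 1 -> u (i, x) = profile u i x.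
Proof.
move=> small1 small2.
have b1 : 1 <= bound by rewrite /bound; have := qplus_gt0; lra.
have l20 : 0 <= lambda ^+ 2 by exact: sqr_ge0.
pose T u (p : bool * R) := profile u p.1 (clamp11 p.2).
have c11 x : -1 <= clamp11 x <= 1 by exact: clamp_itv.
have gcont u i : admissible u -> continuous (green (source u i)).
  move=> Cu; have [? Cg _] := green_C1 (@source_continuous u i Cu).
  exact: C1_continuous Cg.
have := @sup_contraction_fixpoint R _ admissible T (fun=> 0) bound.
case.
- split=> [i x|p]; first exact: cvg_cst.
  by rewrite normr0; lra.
- move=> u Cu; split=> [i|p].
    have cpr : continuous (profile u i).
      move=> x; apply: cvgD; first exact: C1_continuous (ell_C1 i) x.
      by apply: cvgM; [exact: cvg_cst|exact: gcont].
    move=> x; apply: (@continuous_comp _ _ _ clamp11 (profile u i)); last exact: cpr.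
    exact: clamp_continuous.
  rewrite /T /profile (le_trans (ler_normD _ _))// lerD ?ell_bound//.
  rewrite normrM (ger0_norm l20).
  have := green_bound (@source_continuous u p.1 Cu) (fun x => @source_bound u p.1 x Cu) (c11 p.2).
  move=> /(ler_wpM2l l20) /le_trans; apply; move: small2; lra.
- by move=> u [].
- move=> u v e Cu Cv uv p.
  rewrite /T /profile opprD addrACA subrr add0r -mulrBr normrM (ger0_norm l20).
  have := green_lipschitz (@source_continuous u p.1 Cu) (@source_continuous v p.1 Cv)
     (fun x => @source_lipschitz u v e p.1 x Cu Cv uv) (c11 p.2).
  move=> /(ler_wpM2l l20) /le_trans; apply.
  have e0 : 0 <= e by apply: le_trans (uv p).
  rewrite [leLHS](_ : _ = (8 * lip bound * lambda ^+ 2) * (e / 2)); last by field.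
  by rewrite ler_piMl// divr_ge0.
- move=> s u Cs su; split=> [i x|p].
    apply/cvgrPdist_le => e e0.
    have e30 : 0 < e / 3 by rewrite divr_gt0.
    have [n sn] := su _ e30.
    have /cvgrPdist_le/(_ _ e30) near_s := (Cs n).1 i x.
    near=> y.
    have h1 := sn (i, x); have h2 := sn (i, y).
    have h3 : `|s n (i, x) - s n (i, y)| <= e / 3 by near: y.
    move: h1 h2 h3; rewrite !ler_norml.
    move: (u _) (u _) (s n _) (s n _) => ux uy sx sy.
    by move=> /andP[? ?] /andP[? ?] /andP[? ?]; apply/andP; split; lra.
  apply/ler_addgt0Pr => e /su[n sn].
  have := sn p; have := (Cs n).2 p; rewrite !ler_norml.
  by move=> /andP[? ?] /andP[? ?]; apply/andP; split; lra.
move=> u Cu Tu; exists u => // i x x1.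
by rewrite -[LHS]Tu /T /= /clamp11 clamp_id.
Unshelve. all: by end_near. Qed.

(** The profile is smooth and solves the Euler-Lagrange system pointwise on the
    interval; integration by parts turns this into the vanishing of the first
    variation. *)
Lemma critical_point_exists : 0 < lambda -> 8 * lip bound * lambda ^+ 2 <= 1 ->
  4 * lip bound * bound * lambda ^+ 2 <= 1 ->
  exists2 chi, critical_point theta lambda chi & Hee theta chi.
Proof.
move=> l0 small1 small2; have [u Cu uE] := profile_fixpoint small1 small2.
have lam0 : lambda ^+ 2 != 0 by rewrite gt_eqF// exprn_gt0.
pose c i := profile u i; pose s i := source u i.
have sc i : continuous (s i) by exact: source_continuous.
have Cc i : exists2 c', C1 (c i) c' &
    forall x, -1 <= x <= 1 -> c' x = ell' i + lambda ^+ 2 * dgreen (s i) x.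
  have [g' Cg gE] := green_C1 (sc i).
  eexists; first exact: C1D (ell_C1 i) (C1M (C1_cst (lambda ^+ 2)) Cg).
  by move=> x x1; rewrite /= mul0r add0r gE.
(* W agrees with c' on the interval and is continuously differentiable on the
   whole line, as integration by parts requires. *)
have CW i : exists2 W', C1 (fun x => ell' i + lambda ^+ 2 * dgreen (s i) x) W' &
    forall x, -1 <= x <= 1 -> W' x = lambda ^+ 2 * s i x.
  have [g' Cg gE] := dgreen_C1 (sc i).
  eexists; first exact: C1D (C1_cst (ell' i)) (C1M (C1_cst (lambda ^+ 2)) Cg).
  by move=> x x1; rewrite /= mul0r !add0r gE.
have sE i x : -1 <= x <= 1 -> s i x = forcing i (c true x) (c false x).
  by move=> x1; rewrite /s /source !uE.
have cm i : c i (-1) = ell i (-1) by rewrite /c /profile green_m1 mulr0 addr0.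
have cp i : c i 1 = ell i 1 by rewrite /c /profile green_1 mulr0 addr0.
pose chi x : R * R * R := (c true x, c false x, 0).
have H1chi : H1_3 chi.
  split.
  - by have [c' Cc' _] := Cc true; exact: C1_H1 Cc'.
  - by have [c' Cc' _] := Cc false; exact: C1_H1 Cc'.
  - exact: C1_H1 (C1_cst 0).
have Hchi : Hspace theta chi.
  split=> //; rewrite /chi ?cm ?cp /ell ?mulr1//.
  by rewrite mulrN1 mulNr opprK.
exists chi; last by split.
apply/critical_pointP; split=> // P [HP Pm Pp].
have [c1' Cc1 c1E] := Cc true; have [c2' Cc2 c2E] := Cc false.
have [HP1 HP2 HP3] := HP.
have D1 := weak_derivative_spec HP1; have D2 := weak_derivative_spec HP2.
have D3 := weak_derivative_spec HP3.
have [cP1 _ _] := HP1; have [cP2 _ _] := HP2; have [cP3 _ _] := HP3.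
rewrite (first_variationE theta lambda H1chi HP (C1_weak_derivative Cc1)
  (C1_weak_derivative Cc2) (C1_weak_derivative (C1_cst 0)) D1 D2 D3).
have [W1' CW1 W1E] := CW true; have [W2' CW2 W2E] := CW false.
have p1m : (@q1 R \o P) (-1) = 0 by rewrite /comp Pm.
have p1p : (@q1 R \o P) 1 = 0 by rewrite /comp Pp.
have p2m : (@q2 R \o P) (-1) = 0 by rewrite /comp Pm.
have p2p : (@q2 R \o P) 1 = 0 by rewrite /comp Pp.
have n1 : -1 < 1 :> R by lra.
have I1 := weak_ibp cP1 D1 CW1 (lexx _) n1 (lexx _).
have I2 := weak_ibp cP2 D2 CW2 (lexx _) n1 (lexx _).
rewrite p1m p1p !mul0r subrr -/(int11 _) in I1.
rewrite p2m p2p !mul0r subrr -/(int11 _) in I2.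
have LI (p g w w' : R -> R) : cont11 p -> is_weak_derivative p g -> C1 w w' ->
    L1 (fun x => p x * w' x + g x * w x).
  move=> cp' Dp Cw; apply: L1D.
    by apply/cont11_L1/cont11M => //; apply: cont11_continuous; case: Cw.
  by apply: L2_mul; [case: Dp|exact: (cont11_L2 (cont11_continuous (C1_continuous Cw)))].
have LI1 := LI _ _ _ _ cP1 D1 CW1; have LI2 := LI _ _ _ _ cP2 D2 CW2.
pose I (f : R -> R) (_ : L1 f) := int11 f.
have S : 6 / lambda ^+ 2 * I _ LI1 + 2 / lambda ^+ 2 * I _ LI2 = 0.
  apply: etrans (f_equal2 (fun a b => 6 / lambda ^+ 2 * a + 2 / lambda ^+ 2 * b) I1 I2) _.
  by rewrite !mulr0 addr0.
rewrite -[RHS]S /I -(int11Z _ LI1) -(int11Z _ LI2).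
rewrite -(int11D (L1Z _ LI1) (L1Z _ LI2)).
apply: int11_ext => x; rewrite /= in_itv/= => x1.
rewrite /wdot /bulk_poly1 c1E// c2E// W1E// W2E//.
rewrite [dbulk1 _ _ _ _](_ : _ = 6 * s true x); last first.
  by rewrite sE// /forcing; field.
rewrite [dbulk2 _ _ _ _](_ : _ = 2 * s false x); last first.
  by rewrite sE// /forcing; field.
rewrite [dbulk3 _ _ _ _](_ : _ = 0); last by rewrite /dbulk3 /q3 /=; ring.
rewrite /comp /ell'; move: (dgreen _ _) (dgreen _ _) (s _ _) (s _ _) (weak_derivative _ _)
  (weak_derivative _ _) (weak_derivative _ _) (q1 _) (q2 _) (q3 _) => *.
by field; rewrite gt_eqF.
Qed.

End Existence.


(** * Existence and uniqueness for small lambda *)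

Theorem proposition4p2 (R : realType) (theta : R) (htheta : theta < 1) :
  exists lambda0 : R, 0 < lambda0 /\
    forall lambda : R, 0 < lambda -> lambda < lambda0 ->
      exists chi : R -> R * R * R,
        [/\ critical_point theta lambda chi,
            forall Q : R -> R * R * R, critical_point theta lambda Q ->
              forall x : R, x \in `[-1, 1] -> Q x = chi x &
            Hee theta chi].
Proof.
have b1 : 1 <= bound theta by rewrite /bound; have := qplus_gt0 theta; lra.
have l0 : 0 <= lip theta (bound theta).
  by rewrite /lip !addr_ge0 ?mulr_ge0 ?sqr_ge0//; lra.
have th0 := normr_ge0 theta.
pose B := 8 * lip theta (bound theta).
pose B' := 4 * lip theta (bound theta) * bound theta.
pose K := 2 * (30 + `|theta|).
have B0 : 0 <= B by rewrite /B; lra.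
have B'0 : 0 <= B' by rewrite /B' !mulr_ge0//; lra.
have K0 : 0 <= K by rewrite /K; lra.
(* With lambda < 1 / A and A >= 1, also A * lambda^2 < 1, which implies the three
   smallness conditions. *)
pose A := B + B' + K + 1.
have A1 : 1 <= A by rewrite /A; lra.
exists A^-1; split; first by rewrite invr_gt0; lra.
move=> lambda lam0 lamA.
have Al : A * lambda < 1 by rewrite mulrC -ltr_pdivlMr ?mul1r//; lra.
have l1 : lambda <= 1.
  by apply: (@le_trans _ _ (A * lambda)); [rewrite ler_peMl//; lra|exact: ltW].
have small k : 0 <= k -> k <= A -> k * lambda ^+ 2 < 1.
  move=> k0 kA; apply: le_lt_trans Al; rewrite expr2 mulrA.
  apply: (@le_trans _ _ (k * lambda)).
    by rewrite ler_piMr// mulr_ge0// ltW.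
  by rewrite ler_wpM2r// ltW.
have [chi crit ee] := critical_point_exists lam0
  (ltW (small B B0 ltac:(rewrite /A; lra))) (ltW (small B' B'0 ltac:(rewrite /A; lra))).
exists chi; split=> // Q critQ.
exact: critical_point_unique lam0 (small K K0 ltac:(rewrite /A; lra)) critQ crit.
Qed.
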